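(* The map $p\colon\mathbb{H}\to\widehat{\mathbb{C}}$ attains every value in $\widehat{\mathbb{C}}$ infinitely often on $\mathbb{H}$; that is, for each $w\in\widehat{\mathbb{C}}$ there are infinitely many $\tau\in\mathbb{H}$ with $p(\tau)=w$.
   Context: $\mathbb{H}=\{\tau\in\mathbb{C}:\operatorname{Im}(\tau)>0\}$ and $\widehat{\mathbb{C}}=\mathbb{C}\cup\{\infty\}$ is the Riemann sphere. Definition of $p$. Let $\omega_1,\omega_2\in\mathbb{C}\setminus\{0\}$ be linearly independent over $\mathbb{R}$ with $\tau=\omega_1/\omega_2\in\mathbb{H}$, and let $\Gamma=\{k\omega_1+n\omega_2: k,n\in\mathbb{Z}\}$. The Weierstrass zeta-function is $$\zeta(u)=\frac1u+\sum_{\gamma\in\Gamma\setminus\{0\}}\Bigl(\frac{1}{u-\gamma}+\frac1\gamma+\frac{u}{\gamma^2}\Bigr).$$ Its quasi-periods $\eta_1,\eta_2\in\mathbb{C}$ are the constants with $\zeta(u+\omega_k)=\zeta(u)+\eta_k$ for $k=1,2$. They do not both vanish, and $\eta_1/\eta_2\in\widehat{\mathbb{C}}$ depends only on $\tau$. Define $p(\tau)=\eta_1/\eta_2\in\widehat{\mathbb{C}}$; one may take $\omega_1=\tau$, $\omega_2=1$. *)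

(* Defs.v *)
From mathcomp Require Import all_boot all_order all_algebra.
From mathcomp Require Import complex.
From mathcomp Require Import all_classical all_reals all_analysis.
From mathcomp Require summability.
Import numFieldNormedType.Exports.

Set Implicit Arguments.
Unset Strict Implicit.
Unset Printing Implicit Defensive.

Import Order.TTheory GRing.Theory Num.Theory.
Local Open Scope classical_set_scope.
Local Open Scope ring_scope.
Local Open Scope complex_scope.

Definition upper_half_plane (R : realType) : set R[i] :=
  [set tau | 0 < complex.Im tau].

(* [Some z] is the point z of the plane and [None] is the point oo. *)
Definition riemann_sphere (R : realType) : Type :=
  one_point_compactification R[i]^o.

(* The point [a : b] of the sphere; it is meaningful when a and b do not both
   vanish (the junk value at (0, 0) is oo). *)
Definition sphere_ratio (R : realType) (a b : R[i]) : riemann_sphere R :=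
  if b == 0 then None else Some (a / b).

Definition lattice (R : realType) (omega1 omega2 : R[i]) : set R[i] :=
  [set gamma | exists k n : int, gamma = k%:~R * omega1 + n%:~R * omega2].

(* [summability.sum] is the unordered sum: the limit of the finite partial sums
   along the directed set of finite subsets of the index type, here R[i] (with
   R[i]^o carrying the usual topology of the complex plane).  The
   value of [wzeta] is meaningful for u outside the lattice. *)
Definition wzeta (R : realType) (omega1 omega2 u : R[i]) : R[i] :=
  u^-1 +
  summability.sum
    (patch (fun=> 0 : R[i]^o) (lattice omega1 omega2 `\ 0)
       (fun gamma => (u - gamma)^-1 + gamma^-1 + u / gamma ^+ 2)).

(* The constant eta with zeta (u + omega) = zeta u + eta, for omega in the
   lattice; the identity is between finite values, hence u avoids the poles. *)
Definition quasi_period (R : realType) (omega1 omega2 omega : R[i]) : R[i] :=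
  get [set eta : R[i]^o | forall u : R[i], ~ lattice omega1 omega2 u ->
    wzeta omega1 omega2 (u + omega) = wzeta omega1 omega2 u + eta].

Definition p (R : realType) (tau : R[i]) : riemann_sphere R :=
  sphere_ratio (quasi_period tau 1 tau) (quasi_period tau 1 1).

(* Main.v *)
Require Import Defs.
From mathcomp Require Import all_boot all_order all_algebra.
From mathcomp Require Import complex.
From mathcomp Require Import all_classical all_reals all_analysis.
From mathcomp Require Import finmap ring lra zify.
Import Order.TTheory GRing.Theory Num.Theory.
Import numFieldNormedType.Exports.

Set Implicit Arguments.
Unset Strict Implicit.
Unset Printing Implicit Defensive.

Local Open Scope classical_set_scope.
Local Open Scope ring_scope.
Local Open Scope complex_scope.

(* The map p is equivariant: p (-1/s - n) = -1/(p s) - n.  Every SL_2(Z)-orbit on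
   the sphere accumulates at 0, so it is enough that p takes every value in a
   neighbourhood of 0 on a compact subset of the upper half-plane.

   With G(t) = sum_m sum_n (m t + n)^-2, summed by rows, the quasi-periods are
   eta(1) = G(t) and eta(t) = t G(t) - 2 i G(i); the second is Legendre's relation,
   whose constant is independent of t because
   sum_m 1/(z + m) tends to a limit as Im z -> -oo, and is read off at t = i.  Hence
   p t = w iff t = w + 2 i G(i) / G(t).  Removing a telescoping part
   turns G into an absolutely convergent series in which the row m = 0 dominates;
   explicit bounds then show that, for |w| <= 1/20, the right-hand side is a
   contraction of the disc |t - 2i| <= 2/5. *)

(** * Limits of complex sequences *)

(** Origin of the disc: as Im t grows, G(t) tends to the sum of n^-2 over nonzero n, which is
    pi^2/3, and G(i) = pi; for w = 0 the solution therefore lies near 6i/pi, about 1.91 i. On the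
    whole disc the rows m <> 0 are so small that crude bounds, without q-expansions, already give
    the contraction factor 1/2. The obstacle is conditional convergence: summing by rows and by
    columns gives values G and G' with t (G - G') equal to Legendre's constant. The sums of z^-2 are
    therefore taken over boxes with sides K and K^2, where the ends of the long lines contribute
    only O(1/K), and the two orders are compared through an absolutely convergent remainder of order
    z^-6. *)

Notation nrm := Normc.normc.

Section modulus.
Variable R : realType.
Implicit Types x y z : R[i].

Lemma nrmE z : `|z| = (nrm z)%:C.
Proof. by rewrite normc_def; case: z. Qed.

Lemma nrm_ge0 z : 0 <= nrm z.
Proof. by case: z => a b; exact: sqrtr_ge0. Qed.

Lemma nrm0 : nrm (0 : R[i]) = 0. Proof. exact: Normc.normc0. Qed.

Lemma nrm1 : nrm (1 : R[i]) = 1. Proof. exact: Normc.normc1. Qed.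

Lemma nrmM x y : nrm (x * y) = nrm x * nrm y. Proof. exact: Normc.normcM. Qed.

Lemma nrmV x : nrm x^-1 = (nrm x)^-1. Proof. exact: Normc.normcV. Qed.

Lemma nrmN x : nrm (- x) = nrm x. Proof. exact: normcN. Qed.

Lemma nrmX x n : nrm (x ^+ n) = nrm x ^+ n.
Proof. by elim: n => [|n IH]; rewrite ?expr0 ?nrm1// !exprS nrmM IH. Qed.

Lemma nrm_eq0 x : (nrm x == 0) = (x == 0).
Proof. by apply/eqP/eqP => [/Normc.eq0_normc|->] //; exact: nrm0. Qed.

Lemma nrm_gt0 x : (0 < nrm x) = (x != 0).
Proof. by rewrite lt_def nrm_eq0 nrm_ge0 andbT. Qed.

Lemma nrmD x y : nrm (x + y) <= nrm x + nrm y. Proof. exact: le_normcD. Qed.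

Lemma nrmB x y : nrm (x - y) <= nrm x + nrm y.
Proof. by rewrite -(nrmN y) nrmD. Qed.

Lemma nrm_dist x y : nrm (x - y) = nrm (y - x).
Proof. by rewrite -nrmN opprB. Qed.

Lemma nrm_distD z x y : nrm (x - y) <= nrm (x - z) + nrm (z - y).
Proof. by rewrite -{1}(subrK z x) -addrA nrmD. Qed.

Lemma nrm_rev x y : nrm x - nrm y <= nrm (x - y).
Proof. by rewrite lerBlDr -{1}(subrK y x) nrmD. Qed.

Lemma nrm_revD x y : nrm x - nrm y <= nrm (x + y).
Proof. by rewrite -(nrmN y) -{2}(opprK y) nrm_rev. Qed.

Lemma sqr_nrm z : nrm z ^+ 2 = complex.Re z ^+ 2 + complex.Im z ^+ 2.
Proof. by case: z => a b /=; rewrite sqr_sqrtr// addr_ge0 ?sqr_ge0. Qed.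

Lemma nrm_real (a : R) : nrm a%:C = `|a|.
Proof. by rewrite /= expr0n addr0 sqrtr_sqr. Qed.

Lemma nrm_nat n : nrm (n%:R : R[i]) = n%:R.
Proof. by rewrite -(rmorph_nat (real_complex R)) nrm_real normr_nat. Qed.

Lemma nrm_Re z : `|complex.Re z| <= nrm z.
Proof. by rewrite -lecR -nrmE normc_ge_Re. Qed.

Lemma nrm_Im z : `|complex.Im z| <= nrm z.
Proof.
rewrite -(@ler_pXn2r _ 2)// ?nnegrE ?nrm_ge0// sqr_nrm real_normK ?num_real//.
by rewrite lerDr sqr_ge0.
Qed.

Lemma nrm_le_ReIm z : nrm z <= `|complex.Re z| + `|complex.Im z|.
Proof.
rewrite -(@ler_pXn2r _ 2)// ?nnegrE ?nrm_ge0 ?addr_ge0// sqr_nrm sqrrD.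
by rewrite !real_normK ?num_real// addrAC lerDl mulrn_wge0// mulr_ge0.
Qed.

Lemma ReD x y : complex.Re (x + y) = complex.Re x + complex.Re y.
Proof. by case: x y => ? ? []. Qed.

Lemma ImD x y : complex.Im (x + y) = complex.Im x + complex.Im y.
Proof. by case: x y => ? ? []. Qed.

Lemma ReN x : complex.Re (- x) = - complex.Re x.
Proof. by case: x. Qed.

Lemma ImN x : complex.Im (- x) = - complex.Im x.
Proof. by case: x. Qed.

Lemma Re_realM (a : R) z : complex.Re (a%:C * z) = a * complex.Re z.
Proof. by case: z => x y; rewrite /= mul0r subr0. Qed.

Lemma Im_realM (a : R) z : complex.Im (a%:C * z) = a * complex.Im z.
Proof. by case: z => x y; rewrite /= mul0r addr0. Qed.

Lemma Im_int (m : int) : complex.Im (m%:~R : R[i]) = 0.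
Proof. by rewrite -(rmorph_int (real_complex R)). Qed.

Lemma Re_nat n : complex.Re (n%:R : R[i]) = n%:R.
Proof. by rewrite -(rmorph_nat (real_complex R)). Qed.

Lemma nrm_sum (I : Type) (r : seq I) (P : pred I) (F : I -> R[i]) :
  nrm (\sum_(i <- r | P i) F i) <= \sum_(i <- r | P i) nrm (F i).
Proof.
elim/big_ind2 : _ => [|x a y b xa yb|//]; first by rewrite nrm0.
exact: le_trans (nrmD _ _) (lerD xa yb).
Qed.

End modulus.

(** Convergence is measured by the modulus with values in [R], so that every estimate is a real
    inequality within reach of [lra] and [nra]; the norm of [R[i]] has values in [R[i]]. *)
Definition clim (R : realType) (u : nat -> R[i]) (l : R[i]) :=
  forall e : R, 0 < e -> \forall n \near \oo, nrm (u n - l) <= e.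

Section clim.
Variable R : realType.
Implicit Types (u v : nat -> R[i]) (l : R[i]).

Lemma clim_unique u l l' : clim u l -> clim u l' -> l = l'.
Proof.
move=> ul ul'; apply/eqP; rewrite -subr_eq0 -nrm_eq0 eq_le nrm_ge0 andbT.
apply/ler_addgt0Pl => e e0; rewrite addr0.
have e2 : 0 < e / 2 by rewrite divr_gt0.
near \oo => n.
rewrite (le_trans (nrm_distD (u n) _ _))// (splitr e) lerD//.
  by rewrite nrm_dist; near: n; exact: ul.
by near: n; exact: ul'.
Unshelve. all: by end_near.
Qed.

Lemma clim_cst l : clim (fun=> l) l.
Proof. by move=> e e0; near=> n; rewrite subrr nrm0 ltW.
Unshelve. all: by end_near.
Qed.

Lemma climD u v l l' : clim u l -> clim v l' -> clim (fun n => u n + v n) (l + l').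
Proof.
move=> ul vl e e0; have e2 : 0 < e / 2 by rewrite divr_gt0.
near=> n.
rewrite opprD addrACA (le_trans (nrmD _ _))// (splitr e) lerD//.
  by near: n; exact: ul.
by near: n; exact: vl.
Unshelve. all: by end_near.
Qed.

Lemma climZ c u l : clim u l -> clim (fun n => c * u n) (c * l).
Proof.
move=> ul e e0; have c0 : 0 < nrm c + 1 by rewrite ltr_wpDl// nrm_ge0.
have ec : 0 < e / (nrm c + 1) by rewrite divr_gt0.
near=> n.
rewrite -mulrBr nrmM (@le_trans _ _ ((nrm c + 1) * (e / (nrm c + 1))))//.
  rewrite ler_pM ?nrm_ge0// ?lerDl//.
  by near: n; exact: ul.
by rewrite mulrCA divff ?mulr1// gt_eqF.
Unshelve. all: by end_near.
Qed.

Lemma climN u l : clim u l -> clim (fun n => - u n) (- l).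
Proof. by move=> ul e /ul; apply: filterS => n; rewrite -opprD nrmN. Qed.

Lemma climB u v l l' : clim u l -> clim v l' -> clim (fun n => u n - v n) (l - l').
Proof. by move=> ul /climN; exact: climD. Qed.

Lemma clim_near u v l : (\forall n \near \oo, u n = v n) -> clim u l -> clim v l.
Proof. by move=> uv ul e /ul; apply: filterS2 uv => n ->. Qed.

Lemma clim_nrm_le u l (M : R) : clim u l -> (\forall n \near \oo, nrm (u n) <= M) ->
  nrm l <= M.
Proof.
move=> ul uM; apply/ler_addgt0Pl => e e0; near \oo => n.
rewrite -(subrK (u n) l) (le_trans (nrmD _ _))// lerD//.
  by rewrite nrm_dist; near: n; exact: ul.
by near: n.
Unshelve. all: by end_near.
Qed.

Lemma clim_nrm_ge u l (M : R) : clim u l -> (\forall n \near \oo, M <= nrm (u n)) ->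
  M <= nrm l.
Proof.
move=> ul uM; apply/ler_addgt0Pl => e e0; near \oo => n.
apply: (@le_trans _ _ (nrm (u n))); first by near: n.
rewrite -{1}(subrK l (u n)) (le_trans (nrmD _ _))// lerD//.
by near: n; exact: ul.
Unshelve. all: by end_near.
Qed.

Lemma clim_inv u l (M : R) :
  (\forall n \near \oo, nrm (u n - l) <= M / n%:R) -> clim u l.
Proof.
move=> uM e e0; near=> n; apply: (@le_trans _ _ (M / n%:R)); first by near: n.
have n0 : 0 < n%:R :> R by rewrite ltr0n; near: n; exact: nbhs_infty_gt.
rewrite ler_pdivrMr// mulrC -ler_pdivrMr// (le_trans (ler_norm _))//.
apply: (@le_trans _ _ (Num.bound `|M / e|)%:R); first by rewrite ltW// archi_boundP.
by rewrite ler_nat; near: n; exact: nbhs_infty_ge.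
Unshelve. all: by end_near.
Qed.

Lemma cauchy_real (x e : nat -> R) : e @ \oo --> 0 ->
  (forall m n, (n <= m)%N -> `|x m - x n| <= e n) ->
  exists a : R, forall n, `|x n - a| <= e n.
Proof.
move=> e0 ue.
have cu : cvg (x @ \oo).
  apply: cauchy_cvg; apply: cauchy_exP => d d0.
  have : \forall n \near \oo, e n < d.
    move/cvgrPdist_lt : e0 => /(_ _ d0); apply: filterS => n.
    by rewrite sub0r normrN; exact: le_lt_trans (ler_norm _).
  move=> [N _ /(_ N (leqnn N)) eN].
  exists (x N); exists N => // n Nn; rewrite /ball/= distrC.
  exact: le_lt_trans (ue _ _ Nn) eN.
exists (lim (x @ \oo)) => n; rewrite distrC.
apply/ler_addgt0Pl => d d0.
move/cvgrPdist_le : cu => /(_ _ d0) [N _ uN].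
pose m := maxn N n.
rewrite -(subrK (x m) (lim _)) -addrA (le_trans (ler_normD _ _))// lerD//.
  by apply: uN; rewrite /= leq_maxl.
by apply: ue; rewrite leq_maxr.
Qed.

Lemma cauchy_clim u (e : nat -> R) : e @ \oo --> 0 ->
  (forall m n, (n <= m)%N -> nrm (u m - u n) <= e n) ->
  exists l, clim u l.
Proof.
move=> e0 ue.
have [|a ua] := @cauchy_real (fun n => complex.Re (u n)) e e0.
  move=> m n nm; apply: le_trans (ue _ _ nm).
  by rewrite (le_trans _ (nrm_Re _))//; case: (u m) (u n) => ? ? [].
have [|b ub] := @cauchy_real (fun n => complex.Im (u n)) e e0.
  move=> m n nm; apply: le_trans (ue _ _ nm).
  by rewrite (le_trans _ (nrm_Im _))//; case: (u m) (u n) => ? ? [].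
exists (a +i* b) => d d0.
have d2 : 0 < d / 2 by rewrite divr_gt0.
move/cvgrPdist_le : e0 => /(_ _ d2); apply: filterS => n.
rewrite sub0r normrN => /(le_trans (ler_norm _)) en.
rewrite (le_trans (nrm_le_ReIm _))// (splitr d) lerD//.
  by apply: le_trans en; move: (ua n); case: (u n).
by apply: le_trans en; move: (ub n); case: (u n).
Qed.

End clim.

(** * Unordered sums over a lattice *)

(** Enumerating outwards from 0 makes each induction on [K] add one pair of opposite terms. *)
Fixpoint irange (K : nat) : seq int :=
  if K is K'.+1 then K%:Z :: - K%:Z :: irange K' else [:: 0].

Lemma mem_irange K (m : int) : (m \in irange K) = (absz m <= K)%N.
Proof.
elim: K => [|K IH]; first by rewrite /= inE; apply/eqP/idP; lia.
by rewrite /= !inE IH; lia.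
Qed.

Lemma uniq_irange K : uniq (irange K).
Proof.
elim: K => [|K IH] //=; rewrite inE !mem_irange IH negb_or andbT.
by apply/andP; split; [apply/andP; split|]; lia.
Qed.

Lemma size_irange K : size (irange K) = K.*2.+1.
Proof. by elim: K => [|K /= ->]. Qed.

Section irange_sums.
Variable V : zmodType.

Lemma irange_sumS K (F : int -> V) : \sum_(m <- irange K.+1) F m =
  F K.+1%:Z + F (- K.+1%:Z) + \sum_(m <- irange K) F m.
Proof. by rewrite /= !big_cons addrA. Qed.

Lemma irange_telescope K (G : int -> V) :
  \sum_(m <- irange K) (G m - G (m + 1)) = G (- K%:Z) - G (K%:Z + 1).
Proof.
elim: K => [|K IH]; first by rewrite big_seq1 oppr0.
rewrite irange_sumS IH.
have -> : - K.+1%:Z + 1 = - K%:Z by lia.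
have -> : K%:Z + 1 = K.+1%:Z by lia.
by rewrite -addrA subrKA addrC subrKA; congr (_ - G _); lia.
Qed.

Lemma irange_opp K (F : int -> V) :
  \sum_(m <- irange K) F (- m) = \sum_(m <- irange K) F m.
Proof.
elim: K => [|K IH]; first by rewrite !big_seq1 oppr0.
by rewrite !irange_sumS IH opprK (addrC (F _)).
Qed.

Lemma irange_shell K (F : int -> int -> V) :
  \sum_(m <- irange K.+1) \sum_(n <- irange K.+1) F m n =
  \sum_(n <- irange K.+1) (F K.+1%:Z n + F (- K.+1%:Z) n) +
  \sum_(m <- irange K) (F m K.+1%:Z + F m (- K.+1%:Z)) +
  \sum_(m <- irange K) \sum_(n <- irange K) F m n.
Proof.
rewrite (irange_sumS K (fun m => \sum_(n <- irange K.+1) F m n)).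
rewrite [X in _ = X + _ + _]big_split -[RHS]addrA; congr (_ + _).
by rewrite -big_split; apply: eq_bigr => m _; rewrite irange_sumS.
Qed.

End irange_sums.

Lemma irange_sum_le (R : realType) K (F : int -> R) (M : R) :
  (forall m, (absz m <= K)%N -> F m <= M) ->
  \sum_(m <- irange K) F m <= M * K.*2.+1%:R.
Proof.
move=> FM; apply: (@le_trans _ _ (\sum_(m <- irange K) M)).
  by rewrite !big_seq; apply: ler_sum => m; rewrite mem_irange => /FM.
by rewrite big_const_seq count_predT size_irange iter_addr_0 mulr_natr.
Qed.

Section uniq_sums.
Variables (T : eqType).

Lemma sum_uniq_subset (V : zmodType) (s t : seq T) (F : T -> V) :
  uniq s -> uniq t -> {subset s <= t} ->
  \sum_(x <- t) F x = \sum_(x <- s) F x + \sum_(x <- t | x \notin s) F x.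
Proof.
move=> us ut st; rewrite (bigID (mem s))/=; congr (_ + _).
rewrite -big_filter; apply: perm_big; apply: uniq_perm => //.
  by rewrite filter_uniq.
by move=> x; rewrite mem_filter; apply/andP/idP => [[]//|xs]; rewrite xs st.
Qed.

Lemma ler_sum_uniq (R : numDomainType) (s t : seq T) (P : pred T) (F : T -> R) :
  uniq s -> uniq t -> (forall x, 0 <= F x) ->
  (forall x, x \in s -> x \notin t -> F x = 0) ->
  \sum_(x <- s | P x) F x <= \sum_(x <- t | P x) F x.
Proof.
move=> us ut F0 Fst.
rewrite (bigID (mem t))/= [X in _ + X]big1_seq ?addr0; last first.
  by move=> x /andP[/andP[_ xt] xs]; exact: Fst.
rewrite [leRHS](bigID (mem s))/= ler_wpDr//; first exact: sumr_ge0.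
rewrite -big_filter -[leRHS]big_filter le_eqVlt; apply/orP; left; apply/eqP; apply:
    perm_big; apply: uniq_perm.
- by rewrite filter_uniq.
- by rewrite filter_uniq.
- by move=> x; rewrite !mem_filter; case: (P x) (x \in s) (x \in t) => [] [] [].
Qed.

End uniq_sums.

Definition lpt (R : realType) (w1 w2 : R[i]) (m n : int) : R[i] :=
  m%:~R * w1 + n%:~R * w2.

(** Linear independence over the reals in quantitative form; all convergence estimates rest on this
    lower bound. *)
Definition discrete_basis (R : realType) (w1 w2 : R[i]) :=
  exists2 c : R, 0 < c &
    forall m n : int, c * (absz m + absz n)%N%:R <= nrm (lpt w1 w2 m n).

Lemma lptB (R : realType) (w1 w2 : R[i]) m n m' n' :
  lpt w1 w2 m n - lpt w1 w2 m' n' = lpt w1 w2 (m - m') (n - n').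
Proof. by rewrite /lpt !rmorphB/=; ring. Qed.

Lemma lpt_inj (R : realType) (w1 w2 : R[i]) m n m' n' : discrete_basis w1 w2 ->
  lpt w1 w2 m n = lpt w1 w2 m' n' -> (m = m') /\ (n = n').
Proof.
move=> [c c0 cP] /eqP; rewrite -subr_eq0 lptB => /eqP e0.
have := cP (m - m') (n - n'); rewrite e0 nrm0 pmulr_rle0// lern0; lia.
Qed.

#[local] Existing Instance summability.totally_filter.

Section unordered_lattice_sum.
Variables (R : realType) (w1 w2 : R[i]).
Hypothesis basis : discrete_basis w1 w2.

Let box a b : seq R[i] := [seq lpt w1 w2 m n | m <- irange a, n <- irange b].

Let mem_box a b m n :
  (lpt w1 w2 m n \in box a b) = (absz m <= a)%N && (absz n <= b)%N.
Proof.
apply/allpairsP/andP => [[[m' n'] /= [m'a n'b /(lpt_inj basis)[-> ->]]]|[ma nb]].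
  by rewrite -!mem_irange.
by exists (m, n); rewrite /= !mem_irange.
Qed.

Let uniq_box a b : uniq (box a b).
Proof.
apply: allpairs_uniq; rewrite ?uniq_irange// => -[m n] [m' n'] _ _ /=.
by move=> /(lpt_inj basis)[-> ->].
Qed.

(** Cubic decay is summable because a square shell at distance K has O(K) points. Inside the box
    [K0] nothing is required, which leaves room for the lattice points close to the argument of
    zeta. *)
Variables (f : R[i] -> R[i]^o) (M : R) (K0 : nat).
Hypothesis f0 : forall z, ~ lattice w1 w2 z -> f z = 0.
Hypothesis fM : forall m n, (K0 < absz m)%N || (K0 < absz n)%N ->
  nrm (f (lpt w1 w2 m n)) <= M / (absz m + absz n)%N%:R ^+ 3.

Let M0 : 0 <= M.
Proof.
have := @fM K0.+1%:Z 0; rewrite /= ltnSn => /(_ isT) /(le_trans (nrm_ge0 _)).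
by rewrite pmulr_lge0// invr_gt0 exprn_gt0// ltr0n.
Qed.

Let absum K := \sum_(z <- box K K) nrm (f z).

Let absumE K :
  absum K = \sum_(m <- irange K) \sum_(n <- irange K) nrm (f (lpt w1 w2 m n)).
Proof. by rewrite /absum big_allpairs_dep. Qed.

(** The shell has 2 (2K + 3) + 2 (2K + 1) = 8 (K + 1) points, each contributing at most M / (K +
    1)^3. *)
Let absumS K : (K0 <= K)%N -> absum K.+1 - absum K <= 8 * M / K.+1%:R ^+ 2.
Proof.
move=> K0K; rewrite !absumE irange_shell addrK.
have fK m n : (K.+1 <= absz m + absz n)%N -> (K < absz m)%N || (K < absz n)%N ->
    nrm (f (lpt w1 w2 m n)) <= M / K.+1%:R ^+ 3.
  move=> Kmn mn; apply: le_trans (fM _) _; first lia.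
  rewrite ler_wpM2l// lef_pV2 ?posrE ?exprn_gt0 ?ltr0n//; last lia.
  by rewrite lerXn2r ?nnegrE ?ler_nat.
have K1 : K.+1%:R != 0 :> R by rewrite pnatr_eq0.
apply: (@le_trans _ _ (2 * (M / K.+1%:R ^+ 3) * K.+1.*2.+1%:R +
  2 * (M / K.+1%:R ^+ 3) * K.*2.+1%:R)).
  by rewrite lerD//; apply: irange_sum_le => m mK; rewrite mulr_natl mulr2n lerD//
      fK; lia.
have -> : K.+1.*2.+1%:R = 2 * K.+1%:R + 1 :> R by rewrite -natrM natr1; congr (_%:R);
    lia.
have -> : K.*2.+1%:R = 2 * K.+1%:R - 1 :> R.
  by apply/eqP; rewrite eq_sym subr_eq natr1 -natrM; apply/eqP; congr (_%:R); lia.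
by rewrite le_eqVlt; apply/orP; left; apply/eqP; field; rewrite nat1r.
Qed.

Let absum_tail K K' : (K0 < K)%N -> (K <= K')%N ->
  absum K' - absum K <= 8 * M / K%:R.
Proof.
move=> K0K /subnKC <-.
have K1 : 0 < K%:R :> R by rewrite ltr0n; lia.
(* The bound is strengthened by a negative term so that the induction telescopes: 1/(x + 1)^2 <= 1/x
   - 1/(x + 1). *)
apply: (@le_trans _ _ (8 * M * (K%:R^-1 - (K + (K' - K))%:R^-1))); last first.
  rewrite ler_wpM2l//; first by rewrite mulr_ge0.
  by rewrite gerBl invr_ge0.
elim: (K' - K)%N => [|j IH]; first by rewrite addn0 !subrr mulr0.
have Kj1 : 0 < (K + j)%:R :> R by rewrite ltr0n; lia.
rewrite addnS -(subrK (absum (K + j)) (absum _)) -addrA.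
apply: (le_trans (lerD (@absumS (K + j) _) IH)); first lia.
rewrite -mulrDr ler_wpM2l//; first by rewrite mulr_ge0.
set x : R := (K + j)%:R in Kj1 *.
have x1 : 0 < x + 1 by rewrite ltr_wpDl.
suff h : (x + 1) ^- 2 <= x^-1 - (x + 1)^-1 by rewrite -natr1 -/x; lra.
have -> : x^-1 - (x + 1)^-1 = (x + 1)^-1 * x^-1.
  by field; rewrite -natrD -/x (gt_eqF x1) (gt_eqF Kj1).
by rewrite expr2 invfM ler_pM2l ?invr_gt0// lef_pV2 ?posrE// lerDl.
Qed.

Let sum_tail K (B : seq R[i]) : (K0 < K)%N -> uniq B -> {subset box K K <= B} ->
  nrm (\sum_(z <- B) f z - \sum_(z <- box K K) f z) <= 8 * M / K%:R.
Proof.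
move=> K0K uB sB.
(* A finite set [B] may contain points off the lattice, but [f] vanishes there; a large box thus
   holds all that matters in [B]. *)
have [K' BK'] : exists K', forall z, z \in B -> z \notin box K' K' -> nrm (f z) = 0.
  elim: (B) => [|x s [K' IH]]; first by exists 0.
  have [[k [n xkn]]|] := pselect (lattice w1 w2 x); last first.
    move=> /f0 fx; exists K' => z; rewrite inE => /predU1P[->|/IH//].
    by rewrite fx nrm0.
  exists (maxn K' (absz k + absz n)) => z; rewrite inE => /predU1P[->|zs].
    by rewrite xkn -/(lpt w1 w2 k n) mem_box; lia.
  move=> zK; apply: IH => //; apply: contra zK => /allpairsP[[m j] /= [mK jK ->]].
  by move: mK jK; rewrite mem_box !mem_irange; lia.
have KK' : {subset box K K <= box (maxn K K') (maxn K K')}.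
  move=> _ /allpairsP[[m j] /= [mK jK ->]].
  by move: mK jK; rewrite mem_box !mem_irange; lia.
rewrite (sum_uniq_subset _ (uniq_box K K) uB sB) addrAC subrr add0r.
apply: (le_trans (nrm_sum _ _ _)).
apply: (@le_trans _ _ (\sum_(z <- box (maxn K K') (maxn K K') | z \notin box K K) nrm
    (f z))).
  apply: ler_sum_uniq => //; first by move=> z; exact: nrm_ge0.
  move=> z /BK' zB zK; apply: zB; apply: contra zK => /allpairsP[[m j] /= [mK jK ->]].
  by move: mK jK; rewrite mem_box !mem_irange; lia.
rewrite -(addKr (absum K) (\sum_(_ <- _ | _) _)) addrC.
rewrite -(sum_uniq_subset (fun z => nrm (f z)) (uniq_box K K) (uniq_box _ _) KK').
by apply: absum_tail => //; rewrite leq_maxl.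
Qed.

(** [sum_tail] is uniform over all finite sets containing a given box, so one number is both the
    unordered sum and the limit along rectangles of any shape. *)
Lemma lattice_sum : exists l : R[i],
  summability.sum f = l /\
  forall a b : nat -> nat, a @ \oo --> \oo -> b @ \oo --> \oo ->
  clim (fun K => \sum_(m <- irange (a K)) \sum_(n <- irange (b K))
    f (lpt w1 w2 m n)) l.
Proof.
have e0 : (fun n => 8 * M / (n + K0.+1)%:R) @ \oo --> (0 : R).
  under eq_fun do rewrite addnS.
  rewrite -(mulr0 (8 * M)); apply: (@cvgM _ _ _ _ (cst (8 * M)) (fun n => harmonic (n
      + K0))).
    exact: cvg_cst.
  by rewrite cvg_shiftn; exact: cvg_harmonic.
have [|l lP] := @cauchy_clim R (fun n => \sum_(z <- box (n + K0.+1) (n + K0.+1)) f z)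
    _ e0.
  move=> m n nm; apply: sum_tail => //; first lia.
  move=> _ /allpairsP[[k j] /= [mK jK ->]].
  by move: mK jK; rewrite mem_box !mem_irange; lia.
have near_l (e : R) : 0 < e -> exists K, forall B, uniq B -> {subset box K K <= B} ->
    nrm (\sum_(z <- B) f z - l) <= e.
  move=> e_gt0; have e2 : 0 < e / 2 by rewrite divr_gt0.
  have /lP[N1 _ N1P] := e2; move/cvgrPdist_le : e0 => /(_ _ e2)[N2 _ N2P].
  pose n := maxn N1 N2; exists (n + K0.+1)%N => B uB sB.
  rewrite (le_trans (nrm_distD (\sum_(z <- box (n + K0.+1) (n + K0.+1)) f z) _ _))//.
  rewrite (splitr e) lerD//; last by apply: N1P; rewrite /= leq_maxl.
  apply: (le_trans (sum_tail _ uB sB)); first lia.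
  have /= := N2P n; rewrite sub0r normrN => N2n.
  by apply: le_trans (ler_norm _) (N2n _); rewrite leq_maxr.
exists l; split.
  apply: cvg_lim; first exact: norm_hausdorff.
  apply/(@cvgrPdist_le _ R[i]^o) => e e_gt0.
  (* In the order of [R[i]] a positive element is real. *)
  have eE : e = (complex.Re e)%:C by case: e e_gt0 => a b; rewrite ltcE/= =>
      /andP[/eqP ->].
  have [|K KP] := near_l (complex.Re e); first by rewrite -ltcR -eE.
  exists [fset z in box K K]%fset => //= B /fsubsetP sB.
  rewrite /summability.partial_sum -(big_seq_fsetE _ B predT f)/= distrC nrmE eE lecR.
  apply: KP; first exact: fset_uniq.
  by move=> z zK; apply: sB; rewrite !inE.
move=> a b aoo boo e /near_l[K KP].
have ha : \forall n \near \oo, (K <= a n)%N by exact: (aoo _ (nbhs_infty_ge K)).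
have hb : \forall n \near \oo, (K <= b n)%N by exact: (boo _ (nbhs_infty_ge K)).
near=> n; have Ka : (K <= a n)%N by near: n. have Kb : (K <= b n)%N by near: n.
have := KP (box (a n) (b n)) (uniq_box _ _); rewrite big_allpairs_dep; apply.
move=> _ /allpairsP[[k j] /= [mK jK ->]].
by move: mK jK; rewrite mem_box !mem_irange; lia.
Unshelve. all: by end_near.
Qed.

End unordered_lattice_sum.

(** * The zeta function as a limit over boxes *)

Section discrete_bases.
Variable R : realType.
Implicit Types w c tau : R[i].

Lemma discrete_basis_swap w1 w2 : discrete_basis w1 w2 -> discrete_basis w2 w1.
Proof.
by move=> [c c0 cP]; exists c => // m n; rewrite addnC /lpt addrC; exact: cP.
Qed.

Lemma discrete_basis_scale c w1 w2 : c != 0 ->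
  discrete_basis w1 w2 -> discrete_basis (c * w1) (c * w2).
Proof.
rewrite -nrm_gt0 => c0 [d d0 dP]; exists (nrm c * d); first by rewrite mulr_gt0.
move=> m n; have -> : lpt (c * w1) (c * w2) m n = c * lpt w1 w2 m n by rewrite /lpt;
    ring.
by rewrite nrmM -mulrA ler_pM2l.
Qed.

Lemma Im_lpt1 tau m n : complex.Im (lpt tau 1 m n) = m%:~R * complex.Im tau.
Proof.
rewrite /lpt mulr1; case: tau => x y.
rewrite -!(rmorph_int (real_complex R)) /=; ring.
Qed.

Lemma Re_lpt1 tau m n :
  complex.Re (lpt tau 1 m n) = m%:~R * complex.Re tau + n%:~R.
Proof.
rewrite /lpt mulr1; case: tau => x y.
rewrite -!(rmorph_int (real_complex R)) /=; ring.
Qed.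

Lemma nrm_int (m : int) : nrm (m%:~R : R[i]) = (absz m)%:R.
Proof.
rewrite -(rmorph_int (real_complex R)) nrm_real.
by rewrite -intr_norm; case: m => n; rewrite -?NegzE.
Qed.

Lemma discrete_basis_upper tau : 0 < complex.Im tau -> discrete_basis tau 1.
Proof.
move=> y0; have t0 := nrm_ge0 tau.
have D0 : 0 < 1 + complex.Im tau + nrm tau by lra.
(* With N the modulus of m tau + n and y = Im tau, the bounds |m| y <= N and |n| <= N + |m| |tau|
   give (|m| + |n|) y <= N (1 + y + |tau|). *)
exists (complex.Im tau / (1 + complex.Im tau + nrm tau)); first exact: divr_gt0.
move=> m n; rewrite mulrAC ler_pdivrMr//.
have hm : (absz m)%:R * complex.Im tau <= nrm (lpt tau 1 m n).
  apply: le_trans (nrm_Im _); rewrite Im_lpt1 normrM -intr_norm.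
  by rewrite (gtr0_norm y0) natr_absz.
have hn : (absz n)%:R <= nrm (lpt tau 1 m n) + (absz m)%:R * nrm tau.
  rewrite -!nrm_int -nrmM.
  have -> : (n%:~R : R[i]) = lpt tau 1 m n - m%:~R * tau by rewrite /lpt; ring.
  exact: nrmB.
rewrite natrD; have := ler_wpM2l t0 hm; have := ler_wpM2l (ltW y0) hn.
move: (nrm tau) (nrm (lpt tau 1 m n)) (complex.Im tau) hm => T N y; nra.
Qed.

Lemma lattice_swap w1 w2 : lattice w1 w2 = lattice w2 w1.
Proof.
by apply/seteqP; split => z [k [n ->]]; exists n, k; rewrite addrC.
Qed.

Lemma lattice_lpt w1 w2 m n : lattice w1 w2 (lpt w1 w2 m n).
Proof. by exists m, n. Qed.

Lemma lattice_addr w1 w2 z z' : lattice w1 w2 z' ->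
  lattice w1 w2 (z + z') -> lattice w1 w2 z.
Proof.
move=> [k [n ->]] [k' [n' e]]; exists (k' - k), (n' - n).
rewrite -(addrK (k%:~R * w1 + n%:~R * w2) z) e !rmorphB/=; ring.
Qed.

Lemma wzeta_lattice w1 w2 w1' w2' : lattice w1 w2 = lattice w1' w2' ->
  wzeta w1 w2 = wzeta w1' w2'.
Proof. by move=> e; apply/funext => u; rewrite /wzeta e. Qed.

Lemma quasi_period_lattice w1 w2 w1' w2' : lattice w1 w2 = lattice w1' w2' ->
  quasi_period w1 w2 = quasi_period w1' w2'.
Proof.
move=> e; apply/funext => w; rewrite /quasi_period.
by rewrite (wzeta_lattice e) e.
Qed.

End discrete_bases.

Lemma irange_sum0 (V : zmodType) K (F : int -> V) :
  (forall m, m != 0 -> F m = 0) -> \sum_(m <- irange K) F m = F 0.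
Proof.
move=> F0; rewrite (bigD1_seq 0) ?uniq_irange ?mem_irange//= big1 ?addr0//.
Qed.

Lemma cvg_sqn : (fun K : nat => (K * K)%N) @ \oo --> \oo.
Proof.
move=> A [N _ NA]; exists N => // K /= NK; apply: NA => /=.
by rewrite (leq_trans NK)//; case: K NK => // K _; rewrite leq_pmulr.
Qed.

Section quasi_period_limit.
Variables (R : realType) (w1 w2 : R[i]).
Hypothesis basis : discrete_basis w1 w2.

Let lpt0 m n : (lpt w1 w2 m n == 0) = (m == 0) && (n == 0).
Proof.
apply/eqP/andP => [|[/eqP-> /eqP->]]; last by rewrite /lpt !mul0r addr0.
move=> e; have [|-> ->//] := @lpt_inj _ w1 w2 m n 0 0 basis.
by rewrite e /lpt !mul0r addr0.
Qed.

Let zterm (u z : R[i]) : R[i] := (u - z)^-1 + z^-1 + u / z ^+ 2.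

(* As [0^-1 = 0], the term of the summation at the origin is [u^-1]. *)
Lemma wzeta_clim u (a b : nat -> nat) : ~ lattice w1 w2 u ->
  a @ \oo --> \oo -> b @ \oo --> \oo ->
  clim (fun K => \sum_(m <- irange (a K)) \sum_(n <- irange (b K))
    zterm u (lpt w1 w2 m n)) (wzeta w1 w2 u).
Proof.
move=> Lu aoo boo; have [c c0 cP] := basis.
pose f := patch (fun=> 0 : R[i]^o) (lattice w1 w2 `\ 0) (zterm u).
have fE m n : f (lpt w1 w2 m n) =
    if (m == 0) && (n == 0) then 0 else zterm u (lpt w1 w2 m n).
  rewrite /f /patch; case: ifPn => [/set_mem[_ /eqP]|].
    by rewrite lpt0 => /negbTE ->.
  rewrite notin_setE => h; case: ifPn => // mn; exfalso; apply: h.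
  by split; [exact: lattice_lpt|move=> /eqP; rewrite lpt0; exact/negP].
(* Outside this box |z| >= 2 |u|, hence |u - z| >= |z|/2. *)
pose K0 := Num.bound (2 * nrm u / c).
have u0 := nrm_ge0 u.
have K0u : 2 * nrm u < c * K0%:R.
  by rewrite (mulrC c) -ltr_pdivrMr// archi_boundP// divr_ge0 ?mulr_ge0// ltW.
have [|m n mn|l [sl bl]] := @lattice_sum R w1 w2 basis f (2 * nrm u ^+ 2 / c ^+ 3) K0.
- by move=> z Lz; rewrite /f patchE memNset// => -[].
- rewrite fE ifN; last lia.
  set z := lpt w1 w2 m n; set s := (absz m + absz n)%N.
  have s0 : 0 < s%:R :> R by rewrite ltr0n; lia.
  have zs : c * s%:R <= nrm z := cP m n.
  have z0 : 0 < nrm z by apply: lt_le_trans zs; rewrite mulr_gt0.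
  have uz : nrm z / 2 <= nrm (u - z).
    rewrite nrm_dist; apply: le_trans (nrm_rev _ _).
    have : c * K0%:R <= c * s%:R by rewrite ler_pM2l// ler_nat; lia.
    by lra.
  have uz0 : 0 < nrm (u - z) by apply: lt_le_trans uz; rewrite divr_gt0.
  (* The two correcting terms cancel the expansion of (u - z)^-1 up to order z^-2; what is left
     decays like z^-3. *)
  have -> : zterm u z = u ^+ 2 / (z ^+ 2 * (u - z)).
    rewrite /zterm; field.
    by rewrite -!nrm_gt0 z0 uz0.
  rewrite nrmM nrmV nrmM !nrmX; clearbody s.
  move: (s%:R : R) s0 zs => k k0 zk.
  have -> : 2 * nrm u ^+ 2 / c ^+ 3 / k ^+ 3 = nrm u ^+ 2 / ((c * k) ^+ 3 / 2).
    by field; rewrite (gt_eqF c0) (gt_eqF k0).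
  have ck0 : 0 < c * k by rewrite mulr_gt0.
  rewrite ler_wpM2l ?sqr_ge0// lef_pV2 ?posrE; last 2 first.
  + by rewrite mulr_gt0 ?exprn_gt0.
  + by rewrite divr_gt0 ?exprn_gt0.
  apply: (@le_trans _ _ (nrm z ^+ 2 * (nrm z / 2))); last first.
    by rewrite ler_pM2l ?exprn_gt0.
  by rewrite mulrA -exprSr ler_pM2r ?invr_gt0// lerXn2r// nnegrE ltW.
have -> : wzeta w1 w2 u = u^-1 + l by rewrite /wzeta -sl.
have := climD (clim_cst (u^-1)) (bl a b aoo boo).
congr clim; apply/funext => K.
have -> : u^-1 = \sum_(m <- irange (a K)) \sum_(n <- irange (b K))
    (if (m == 0) && (n == 0) then u^-1 else 0).
  rewrite irange_sum0 => [|m /negbTE ->]; last by rewrite big1.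
  by rewrite irange_sum0 ?eqxx// => n /negbTE ->.
rewrite -big_split; apply: eq_bigr => m _; rewrite -big_split; apply: eq_bigr => n _.
rewrite /= fE; case: ifPn => [|_]; last by rewrite add0r.
by rewrite -lpt0 => /eqP ->; rewrite addr0 /zterm invr0 expr0n invr0 mulr0 !addr0 subr0.
Qed.

(** In zeta(u + w2) - zeta(u) the terms 1/z cancel, the terms (u - z)^-1 telescope along each row,
    and w2/z^2 remains. There are 2K + 1 rows of length of order K^2, so their ends contribute (2K +
    1) O(K^-2) = O(1/K): this is why rows are longer than columns. *)
Lemma wzeta_shift_clim u : ~ lattice w1 w2 u ->
  clim (fun K => w2 * \sum_(m <- irange K) \sum_(n <- irange (K * K))
    lpt w1 w2 m n ^- 2) (wzeta w1 w2 (u + w2) - wzeta w1 w2 u).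
Proof.
move=> Lu; have [c c0 cP] := basis.
have L2 : lattice w1 w2 w2 by exists 0, 1; rewrite mul0r add0r mul1r.
have Lu2 : ~ lattice w1 w2 (u + w2) by move=> /(lattice_addr L2).
have := climB (wzeta_clim Lu2 cvg_id cvg_sqn) (wzeta_clim Lu cvg_id cvg_sqn).
set F := fun K => _.
pose G m n := (u + w2 - lpt w1 w2 m n)^-1.
have FE K : F K = \sum_(m <- irange K) (G m (- (K * K)%:Z) - G m ((K * K)%:Z + 1)) +
    w2 * \sum_(m <- irange K) \sum_(n <- irange (K * K)) lpt w1 w2 m n ^- 2.
  rewrite /F -sumrB mulr_sumr -big_split; apply: eq_bigr => m _.
  rewrite -(irange_telescope (K * K) (G m)) -sumrB mulr_sumr -big_split.
  apply: eq_bigr => n _ /=.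
  have -> : G m (n + 1) = (u - lpt w1 w2 m n)^-1.
    by rewrite /G /lpt rmorphD/=; congr (_^-1); ring.
  by rewrite /G /zterm mulrDl; ring.
move=> Fl; rewrite -[X in clim _ X]subr0.
have u0 := nrm_ge0 u.
apply: (@clim_near _ (fun K => F K - \sum_(m <- irange K)
    (G m (- (K * K)%:Z) - G m ((K * K)%:Z + 1)))).
  by near=> K; rewrite FE addrC addKr.
apply: climB Fl _; apply: (@clim_inv _ _ _ (12 / c)).
near=> K; rewrite subr0.
have K0 : (0 < K)%N by near: K; exact: nbhs_infty_gt.
have Ku : 2 * nrm u / c < K%:R.
  apply: (@lt_le_trans _ _ (Num.bound (2 * nrm u / c))%:R).
    by rewrite archi_boundP// divr_ge0 ?mulr_ge0// ltW.
  by rewrite ler_nat; near: K; exact: nbhs_infty_ge.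
have K1 : 1 <= K%:R :> R by rewrite ler1n.
rewrite ltr_pdivrMr// in Ku.
have far m n : (K * K <= absz n)%N -> nrm (u - lpt w1 w2 m n)^-1 <= 2 / c / (K%:R *
    K%:R).
  move=> Kn; rewrite nrmV.
  have -> : 2 / c / (K%:R * K%:R) = (c * (K%:R * K%:R) / 2)^-1.
    by field; rewrite (gt_eqF c0) pnatr_eq0; lia.
  have H : c * (K%:R * K%:R) <= nrm (lpt w1 w2 m n).
    by apply: le_trans (cP m n); rewrite ler_pM2l// -natrM ler_nat; lia.
  have H2 : K%:R * c <= c * (K%:R * K%:R) by rewrite mulrC ler_pM2l// ler_peMr.
  have H3 := nrm_rev (lpt w1 w2 m n) u; rewrite nrm_dist in H3.
  have H4 : 0 < c * (K%:R * K%:R) by rewrite !mulr_gt0// ltr0n.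
  by rewrite lef_pV2 ?posrE; lra.
apply: (@le_trans _ _ (4 / c / (K%:R * K%:R) * K.*2.+1%:R)).
  rewrite (le_trans (nrm_sum _ _ _))//; apply: irange_sum_le => m mK.
  rewrite (le_trans (nrmB _ _))//.
  have -> : 4 / c / (K%:R * K%:R) = 2 / c / (K%:R * K%:R) + 2 / c / (K%:R * K%:R) by
      field; lra.
  rewrite lerD//.
    have -> : G m (- (K * K)%:Z) = (u - lpt w1 w2 m (- (K * K)%:Z - 1))^-1.
      by rewrite /G /lpt rmorphB/=; congr (_^-1); ring.
    by apply: far; lia.
  have -> : G m ((K * K)%:Z + 1) = (u - lpt w1 w2 m (K * K)%:Z)^-1.
    by rewrite /G /lpt rmorphD/=; congr (_^-1); ring.
  by apply: far; lia.
have -> : K.*2.+1%:R = 2 * K%:R + 1 :> R by rewrite -natrM natr1 mul2n.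
move: K1; set k : R := K%:R; clearbody k => k1.
have k0 : 0 < k by lra.
have -> : 4 / c / (k * k) * (2 * k + 1) = (4 / c / k) * ((2 * k + 1) / k) by field; lra.
have -> : 12 / c / k = (4 / c / k) * 3 by ring.
by rewrite ler_pM2l ?divr_gt0// ler_pdivrMr//; lra.
Unshelve. all: by end_near.
Qed.

End quasi_period_limit.

(** * Quasi-periods and equivariance *)

Definition is_quasi_period (R : realType) (w1 w2 w eta : R[i]) :=
  forall u, ~ lattice w1 w2 u -> wzeta w1 w2 (u + w) = wzeta w1 w2 u + eta.

(* The double series is only conditionally convergent: the rows are much longer
   than the number of rows, so that each of them is summed first. *)
Definition eisenstein2 (R : realType) (w1 w2 G : R[i]) :=
  clim (fun K => \sum_(m <- irange K) \sum_(n <- irange (K * K))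
    lpt w1 w2 m n ^- 2) G.

Section quasi_periods.
Variable R : realType.
Implicit Types w c eta G u : R[i].

(** A half-period will do, by parity. Such a point keeps the condition defining a quasi-period from
    being vacuous, and so makes its solution unique. *)
Lemma off_lattice w1 w2 : discrete_basis w1 w2 -> exists u, ~ lattice w1 w2 u.
Proof.
move=> basis; exists ((w1 + w2) / 2) => -[k [n e]].
have [|+ _] := @lpt_inj _ w1 w2 (k + k) (n + n) 1 1 basis; last by lia.
by rewrite /lpt !rmorphD/= !mul1r -[RHS](@divfK _ 2) ?pnatr_eq0// e; ring.
Qed.

Lemma quasi_periodE w1 w2 w eta : discrete_basis w1 w2 ->
  is_quasi_period w1 w2 w eta -> quasi_period w1 w2 w = eta.
Proof.
move=> /off_lattice[u Lu] weta; rewrite /quasi_period.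
set A := mkset _; have : A (get A) by apply: getPex; exists eta.
by move=> /(_ u Lu); rewrite weta// => /addrI.
Qed.

Lemma is_quasi_periodD w1 w2 w eta w' eta' : lattice w1 w2 w ->
  is_quasi_period w1 w2 w eta -> is_quasi_period w1 w2 w' eta' ->
  is_quasi_period w1 w2 (w + w') (eta + eta').
Proof.
move=> Lw we w'e u Lu; rewrite !addrA w'e ?we//.
by move=> /(lattice_addr Lw).
Qed.

Lemma lattice_opp w1 w2 w : lattice w1 w2 w -> lattice w1 w2 (- w).
Proof. by move=> [k [n ->]]; exists (- k), (- n); rewrite !rmorphN/=; ring. Qed.

Lemma is_quasi_periodN w1 w2 w eta : lattice w1 w2 w ->
  is_quasi_period w1 w2 w eta -> is_quasi_period w1 w2 (- w) (- eta).
Proof.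
move=> Lw we u Lu; apply/eqP; rewrite eq_sym subr_eq eq_sym -we ?subrK//.
by move=> /(lattice_addr (lattice_opp Lw)).
Qed.

Lemma is_quasi_periodMn w1 w2 w eta n : lattice w1 w2 w ->
  is_quasi_period w1 w2 w eta -> is_quasi_period w1 w2 (w *+ n) (eta *+ n).
Proof.
move=> Lw we; elim: n => [|n IH]; first by move=> u _; rewrite !mulr0n !addr0.
by rewrite !mulrS; exact: is_quasi_periodD.
Qed.

Lemma discrete_basis_neq0 w1 w2 : discrete_basis w1 w2 -> w2 != 0.
Proof.
move=> basis; apply/eqP => w20.
have [|_] := @lpt_inj _ w1 w2 0 1 0 0 basis; last by [].
by rewrite /lpt w20 !mulr0.
Qed.

(** The sums in [wzeta_shift_clim] do not involve u, so the increment of zeta is constant off the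
    lattice; this gives existence and value of the quasi-period together. *)
Lemma eisenstein2_quasi_period w1 w2 : discrete_basis w1 w2 ->
  exists2 G, eisenstein2 w1 w2 G & is_quasi_period w1 w2 w2 (w2 * G).
Proof.
move=> basis; have w20 := discrete_basis_neq0 basis.
have [u Lu] := off_lattice basis.
have lu := wzeta_shift_clim basis Lu.
have Gl : eisenstein2 w1 w2 (w2^-1 * (wzeta w1 w2 (u + w2) - wzeta w1 w2 u)).
  by have := climZ w2^-1 lu; congr clim; apply/funext => K; rewrite mulKf.
exists (w2^-1 * (wzeta w1 w2 (u + w2) - wzeta w1 w2 u)) => // v Lv.
rewrite mulVKf// (clim_unique lu (wzeta_shift_clim basis Lv)).
by rewrite [RHS]addrC subrK.
Qed.

Lemma quasi_period_eisenstein2 w1 w2 G : discrete_basis w1 w2 ->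
  eisenstein2 w1 w2 G -> quasi_period w1 w2 w2 = w2 * G.
Proof.
move=> basis; have [G' /clim_unique G'P w2G'] := eisenstein2_quasi_period basis.
by move=> /G'P <-; exact: quasi_periodE.
Qed.

Lemma eisenstein2_scale c w1 w2 G : eisenstein2 w1 w2 G ->
  eisenstein2 (c * w1) (c * w2) (c ^- 2 * G).
Proof.
move=> /(climZ (c ^- 2)); congr clim; apply/funext => K.
rewrite mulr_sumr; apply: eq_bigr => m _; rewrite mulr_sumr; apply: eq_bigr => n _.
rewrite -invfM -exprMn; congr (_ ^- 2); rewrite /lpt; ring.
Qed.

Lemma quasi_period_scale c w1 w2 : c != 0 -> discrete_basis w1 w2 ->
  quasi_period (c * w1) (c * w2) (c * w2) = c^-1 * quasi_period w1 w2 w2.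
Proof.
move=> c0 basis; have [G GP w2G] := eisenstein2_quasi_period basis.
rewrite (quasi_periodE basis w2G).
rewrite (quasi_period_eisenstein2 (discrete_basis_scale c0 basis) (eisenstein2_scale
    c GP)).
by field.
Qed.

(** * The action of s -> -1/s - n on quasi-periods *)

Section transform.
Variables (s : R[i]) (n : nat).
Hypothesis s_upper : 0 < complex.Im s.
Let t := - s^-1 - n%:R.

Let s0 : s != 0.
Proof. by apply: contraTneq s_upper => ->; rewrite ltxx. Qed.

Lemma transform_upper : 0 < complex.Im t.
Proof.
rewrite /t; case: s s_upper s0 => x y /= y0 xy0.
rewrite -(rmorph_nat (real_complex R)) /= oppr0 addr0 opprK divr_gt0//.
by rewrite ltr_wpDl ?sqr_ge0// exprn_gt0.
Qed.

Let basis_s : discrete_basis s 1 := discrete_basis_upper s_upper.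
Let basis_t : discrete_basis t 1 := discrete_basis_upper transform_upper.

Let stE : s * t = - (1 + s *+ n).
Proof. by rewrite /t -mulr_natr; field. Qed.

(** Since quasi-periods are homogeneous of degree -1, those for t at 1 and t are s times those for s
    at the lattice vectors s and s t. *)
Let lattice_st : lattice (s * t) (s * 1) = lattice s 1.
Proof.
rewrite stE; apply/seteqP; split => z [k [j ->]].
  exists (j - k * n%:Z), (- k).
  by rewrite rmorphB rmorphN rmorphM/= -mulr_natr -pmulrn; ring.
exists (- j), (k - j * n%:Z).
by rewrite rmorphB rmorphN rmorphM/= -mulr_natr -pmulrn; ring.
Qed.

Lemma quasi_period_transform1 : quasi_period t 1 1 = s * quasi_period s 1 s.
Proof.
rewrite -(mulVKf s0 (quasi_period t 1 1)) -quasi_period_scale//.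
by rewrite (quasi_period_lattice lattice_st) mulr1.
Qed.

Lemma quasi_period_transformt :
  quasi_period t 1 t = - (s * (quasi_period s 1 1 + quasi_period s 1 s *+ n)).
Proof.
have basis_s' := discrete_basis_swap basis_s.
have [G1 _ qp1] := eisenstein2_quasi_period basis_s.
have [G2 _ qp2] := eisenstein2_quasi_period basis_s'.
have {}qp2 : is_quasi_period s 1 s (s * G2).
  by move: qp2; rewrite /is_quasi_period lattice_swap (wzeta_lattice (lattice_swap 1
      s)).
rewrite (quasi_periodE basis_s qp1) (quasi_periodE basis_s qp2).
have L1 : lattice s 1 1 by exists 0, 1; rewrite mul0r add0r mulr1.
have Ls : lattice s 1 s by exists 1, 0; rewrite mul0r addr0 mul1r.
have qpt : is_quasi_period s 1 (s * t) (- (1 * G1 + (s * G2) *+ n)).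
  rewrite stE; apply: is_quasi_periodN.
    by exists n%:Z, 1; rewrite mulr1 -pmulrn mulr_natl addrC.
  by apply: is_quasi_periodD => //; exact: is_quasi_periodMn.
rewrite (quasi_period_lattice (lattice_swap t 1)) -mulrN.
rewrite -(mulVKf s0 (quasi_period 1 t t)); congr (_ * _).
rewrite -quasi_period_scale//; last exact: discrete_basis_swap.
rewrite (quasi_period_lattice (lattice_swap _ _)) (quasi_period_lattice lattice_st).
exact: quasi_periodE basis_s qpt.
Qed.

Lemma p_transform v : p s = Some v ->
  p t = if v == 0 then None else Some (- v^-1 - n%:R).
Proof.
rewrite /p quasi_period_transform1 quasi_period_transformt /sphere_ratio.
case: ifPn => // e1 [<-]; rewrite mulf_eq0 (negbTE s0)/=.
(* As [p s] is finite, the quasi-period of 1 is nonzero; if that of s vanishes, the numerator of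
   [p t] does not, and [None] is the true point at infinity. *)
have [->|e2] := eqVneq (quasi_period s 1 s) 0; first by rewrite mul0r eqxx.
rewrite mulf_eq0 (negbTE e2) invr_eq0 (negbTE e1)/=; congr Some.
rewrite -mulr_natr; move: (quasi_period s 1 1) (quasi_period s 1 s) e1 e2 => a b a0 b0.
by field; rewrite a0 b0 s0.
Qed.

End transform.
End quasi_periods.

(** * The limit of the cotangent sums *)

(** Repeated bisection: k halvings bring a distance at most 2^k below 1, and Lipschitz bounds add up
    along the segment without loss. *)
Lemma lipschitz_of_local (R : realType) (D : set R[i]) (F : R[i] -> R[i]) (e : R) :
  (forall z z', D z -> D z' -> D ((z + z') / 2)) ->
  (forall z z', D z -> D z' -> nrm (z - z') <= 1 ->
    nrm (F z - F z') <= nrm (z - z') * e) ->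
  forall z z', D z -> D z' -> nrm (F z - F z') <= nrm (z - z') * e.
Proof.
move=> Dmid loc z z' Dz Dz'.
have [k] : exists k, nrm (z - z') <= (2 ^ k)%:R.
  exists (Num.bound (nrm (z - z'))); rewrite ltW//.
  apply: (@lt_trans _ _ (Num.bound (nrm (z - z')))%:R).
    by rewrite archi_boundP// nrm_ge0.
  by rewrite ltr_nat ltn_expl.
elim: k z z' Dz Dz' => [|k IH] z z' Dz Dz' zz'; first exact: loc.
pose w := (z + z') / 2; have Dw : D w by exact: Dmid.
have n2 : nrm (2 : R[i])^-1 = 2^-1 by rewrite nrmV nrm_nat.
have zw : nrm (z - w) = nrm (z - z') / 2.
  have -> : z - w = (z - z') / 2 by rewrite /w; field.
  by rewrite nrmM n2.
have wz' : nrm (w - z') = nrm (z - z') / 2.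
  have -> : w - z' = (z - z') / 2 by rewrite /w; field.
  by rewrite nrmM n2.
have h : nrm (z - z') / 2 <= (2 ^ k)%:R by move: zz'; rewrite expnS natrM; lra.
have := IH z w Dz Dw; have := IH w z' Dw Dz'; rewrite zw wz' => /(_ h) h1 /(_ h) h2.
by have := nrm_distD (F w) (F z) (F z'); lra.
Qed.

(** Symmetric partial sum of pi cot(pi z). *)
Definition cotangent_sum (R : realType) (M : nat) (z : R[i]) : R[i] :=
  \sum_(m <- irange M) (z + m%:~R)^-1.

Section cotangent_sums.
Variable R : realType.

Let region (X Y : R) : set R[i] :=
  [set z | complex.Im z <= - Y /\ `|complex.Re z| <= X].

Let region_mid X Y z z' : region X Y z -> region X Y z' -> region X Y ((z + z') / 2).
Proof.
move=> [y1 /ler_normlP[x1 x2]] [y1' /ler_normlP[x1' x2']].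
have -> : (z + z') / 2 = (2^-1)%:C * (z + z') by rewrite fmorphV rmorph_nat mulrC.
split; rewrite ?Im_realM ?Re_realM ?ImD ?ReD; first lra.
by apply/ler_normlP; split; lra.
Qed.

(* With [w = (z + z') / 2], the comparison with [1 / ((w + m)^2 - 1/4)] makes the
   main part telescope, and leaves terms of order [Y ^ -4]. *)
Let cotangent_sum_local M X Y z z' : 2 <= Y -> X < M%:R -> region X Y z -> region X Y
    z' ->
  nrm (z - z') <= 1 ->
  nrm (cotangent_sum M z - cotangent_sum M z') <=
    nrm (z - z') * (M.*2.+1%:R / Y ^+ 4 + 2 / (M%:R - X)).
Proof.
move=> Y2 XM rz rz' zz'.
pose w := (z + z') / 2; pose d := (z - z') / 2.
have Y0 : 0 < Y by lra.
have [wY wX] : region X Y w by exact: region_mid.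
have vY (m : int) : Y <= nrm (w + m%:~R).
  apply: le_trans (nrm_Im _); rewrite ImD Im_int addr0.
  by rewrite -normrN (le_trans _ (ler_norm _))// lerNr.
have d1 : nrm d <= 2^-1 by rewrite nrmM nrmV nrm_nat; lra.
have d0 := nrm_ge0 d.
(* Both lower bounds are 3/4 |v|^2, from |v| >= 2 and |d| <= 1/2; the latter is where closeness of z
   and z' enters. *)
have far v : Y <= nrm v -> 2^-1 * nrm v ^+ 2 + nrm v ^+ 2 / 4 <= nrm (v ^+ 2 - d ^+
    2) /\
    2^-1 * nrm v ^+ 2 + nrm v ^+ 2 / 4 <= nrm (v ^+ 2 - 4^-1).
  move=> vY'; split.
    by have := nrm_rev (v ^+ 2) (d ^+ 2); rewrite !nrmX; nra.
  by have := nrm_rev (v ^+ 2) (4^-1); rewrite !nrmX nrmV nrm_nat; nra.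
have neq0 v : Y <= nrm v -> (v ^+ 2 - d ^+ 2 != 0) * (v ^+ 2 - 4^-1 != 0).
  move=> vY'; have [h1 h2] := far v vY'.
  by rewrite -!nrm_gt0; split; apply: lt_le_trans; [|exact: h1| |exact: h2]; nra.
have invB (a b : R[i]) : a != 0 -> b != 0 -> a^-1 - b^-1 = (b - a) / (a * b).
  by move=> a0 b0; field; rewrite a0 b0.
have -> : cotangent_sum M z - cotangent_sum M z' = (z' - z) *
   (\sum_(m <- irange M) (((w + m%:~R) ^+ 2 - d ^+ 2)^-1 - ((w + m%:~R) ^+ 2 -
       4^-1)^-1) +
    ((w - M%:R - 2^-1)^-1 - (w + M%:R + 2^-1)^-1)).
  have -> : (w - M%:R - 2^-1)^-1 - (w + M%:R + 2^-1)^-1 =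
      \sum_(m <- irange M) ((w + m%:~R) ^+ 2 - 4^-1)^-1.
    have := irange_telescope M (fun m : int => (w + m%:~R - 2^-1)^-1).
    rewrite rmorphN rmorphD/= -!pmulrn.
    have -> : w + (M%:R + 1) - 2^-1 = w + M%:R + 2^-1 by field.
    move=> <-; apply: eq_bigr => m _; have [_] := neq0 _ (vY m).
    have -> : (w + m%:~R) ^+ 2 - 4^-1 = (w + m%:~R - 2^-1) * (w + (m + 1)%:~R - 2^-1).
      by rewrite rmorphD/=; field.
    rewrite mulf_eq0 => /norP[a0 b0].
    by rewrite invB// [X in X / _](_ : _ = 1) ?mul1r// rmorphD/=; ring.
  rewrite -big_split mulr_sumr -sumrB; apply: eq_bigr => m _ /=; rewrite subrK.
  have [+ _] := neq0 _ (vY m).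
  have zE : z + m%:~R = w + m%:~R + d by rewrite /w /d; field.
  have zE' : z' + m%:~R = w + m%:~R - d by rewrite /w /d; field.
  rewrite subr_sqr -zE -zE' mulf_eq0 => /norP[b0 a0].
  by rewrite invB// [(z + _) * _]mulrC; congr (_ / _); ring.
rewrite nrmM nrm_dist ler_wpM2l ?nrm_ge0// (le_trans (nrmD _ _))// lerD//.
  rewrite (le_trans (nrm_sum _ _ _))// mulrC; apply: irange_sum_le => m _.
  move: (vY m) (neq0 _ (vY m)) (far _ (vY m)); move: (w + m%:~R) => v Yv [v1 v2] [h1
      h2].
  have -> : (v ^+ 2 - d ^+ 2)^-1 - (v ^+ 2 - 4^-1)^-1 =
      (d ^+ 2 - 4^-1) / ((v ^+ 2 - d ^+ 2) * (v ^+ 2 - 4^-1)).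
    by rewrite invB//; congr (_ / _); ring.
  have n1 : nrm (d ^+ 2 - 4^-1) <= 2^-1.
    by have := nrmB (d ^+ 2) (4^-1); rewrite nrmX nrmV nrm_nat; nra.
  have n2 : Y ^+ 4 / 2 <= nrm ((v ^+ 2 - d ^+ 2) * (v ^+ 2 - 4^-1)).
    rewrite nrmM; apply: (@le_trans _ _ ((3/4 * Y ^+ 2) * (3 / 4 * Y ^+ 2))).
      have -> : Y ^+ 4 = Y ^+ 2 * Y ^+ 2 by rewrite -exprD.
      by have := mulr_ge0 (sqr_ge0 Y) (sqr_ge0 Y); lra.
    by apply: ler_pM; nra.
  have Y4 : 0 < Y ^+ 4 by rewrite exprn_gt0.
  rewrite nrmM nrmV ler_pdivrMr; last by lra.
  by rewrite mulrC ler_pdivlMr//; nra.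
have MX : 0 < M%:R - X by lra.
have bd v : M%:R - X <= nrm v -> nrm v^-1 <= (M%:R - X)^-1.
  by move=> h; rewrite nrmV lef_pV2 ?posrE//; lra.
move/ler_normlP : wX => [wX1 wX2].
have half : 2^-1 = (2^-1)%:C :> R[i] by rewrite fmorphV rmorph_nat.
rewrite (le_trans (nrmB _ _))// [leRHS]mulrDl mul1r lerD//; apply: bd.
  rewrite -nrmN; apply: le_trans (nrm_Re _); apply: le_trans (ler_norm _).
  by rewrite !opprD !opprK half !ReD !ReN Re_nat/=; lra.
apply: le_trans (nrm_Re _); apply: le_trans (ler_norm _).
by rewrite half !ReD Re_nat/=; lra.
Qed.

Lemma cotangent_sum_lipschitz (M : nat) (X Y : R) z z' : 2 <= Y -> X < M%:R ->
  complex.Im z <= - Y /\ `|complex.Re z| <= X ->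
  complex.Im z' <= - Y /\ `|complex.Re z'| <= X ->
  nrm (cotangent_sum M z - cotangent_sum M z') <=
    nrm (z - z') * (M.*2.+1%:R / Y ^+ 4 + 2 / (M%:R - X)).
Proof.
move=> Y2 XM rz rz'.
apply: (@lipschitz_of_local _ (region X Y)) => //; first exact: region_mid.
by move=> u v ru rv uv; exact: cotangent_sum_local.
Qed.

End cotangent_sums.

Section cotangent_limit.
Variable R : realType.

Let half_int (K : nat) : R := K%:R + 2^-1.

(** The arguments move down linearly in K, and so does their distance grow; with K^2 in the role of
    M the Lipschitz constant is O(K^-2), so the difference is O(1/K). *)
Lemma cotangent_sum_clim (z z' : R[i]) : complex.Im z < 0 -> complex.Im z' < 0 ->
  clim (fun K => cotangent_sum (K * K) ((half_int K)%:C * z) -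
                 cotangent_sum (K * K) ((half_int K)%:C * z')) 0.
Proof.
move=> z0 z0'.
pose k := Num.min (- complex.Im z) (- complex.Im z').
have k0 : 0 < k by rewrite lt_min !oppr_gt0 z0 z0'.
have kz : complex.Im z <= - k by rewrite lerNr ge_min lexx.
have kz' : complex.Im z' <= - k by rewrite lerNr ge_min lexx orbT.
pose r := nrm z + nrm z'.
have r0 : 0 <= r by rewrite addr_ge0 ?nrm_ge0.
apply: (@clim_inv _ _ _ (3 * r / k ^+ 4 + 8 * r)); near=> K; rewrite subr0.
have K1 : 1 <= K%:R :> R by rewrite ler1n; near: K; exact: nbhs_infty_gt.
have Kk : 2 / k <= K%:R.
  apply: (@le_trans _ _ (Num.bound (2 / k))%:R).
    by rewrite ltW// archi_boundP// divr_ge0// ltW.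
  by rewrite ler_nat; near: K; exact: nbhs_infty_ge.
have Kr : 4 * r <= K%:R.
  apply: (@le_trans _ _ (Num.bound (4 * r))%:R).
    by rewrite ltW// archi_boundP// mulr_ge0.
  by rewrite ler_nat; near: K; exact: nbhs_infty_ge.
set t := half_int K.
have tK : K%:R <= t by rewrite lerDl.
have tK2 : t <= 2 * K%:R by rewrite /t /half_int; lra.
have t0 : 0 < t by lra.
have rt : r * t <= K%:R * K%:R / 2 by nra.
have inD y : complex.Im y <= - k -> nrm y <= r ->
    complex.Im (t%:C * y) <= - (k * t) /\ `|complex.Re (t%:C * y)| <= r * t.
  move=> yk yr; rewrite Im_realM Re_realM normrM (gtr0_norm t0); split; first by nra.
  by rewrite mulrC ler_pM2r// (le_trans (nrm_Re _)).
have zr : nrm z <= r by rewrite lerDl nrm_ge0.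
have zr' : nrm z' <= r by rewrite lerDr nrm_ge0.
have kt : 2 <= k * t by rewrite ler_pdivrMr// in Kk; nra.
have XM : r * t < (K * K)%:R by rewrite natrM; nra.
have := cotangent_sum_lipschitz kt XM (inD _ kz zr) (inD _ kz' zr').
move=> /le_trans; apply; rewrite natrM.
have -> : (K * K).*2.+1%:R = 2 * (K%:R * K%:R) + 1 :> R by rewrite -!natrM natr1 mul2n.
have zz' : nrm (t%:C * z - t%:C * z') <= t * r.
  by rewrite -mulrBr nrmM nrm_real gtr0_norm// ler_pM2l// nrmB.
move: (K%:R : R) K1 tK tK2 rt Kr => x x1 xt tx rt rx.
have x0 : 0 < x by lra.
have xx0 : 0 < x * x by rewrite mulr_gt0.
have D0 : 0 < x * x - r * t by lra.
apply: (@le_trans _ _ (t * r * ((2 * (x * x) + 1) / (k * t) ^+ 4 + 2 / (x * x - r *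
    t)))).
  rewrite ler_wpM2r// addr_ge0// divr_ge0//; last exact: ltW.
  - by nra.
  - by rewrite exprn_ge0// mulr_ge0// ltW.
rewrite mulrDr [leRHS]mulrDl lerD//.
  rewrite exprMn; have k4 : 0 < k ^+ 4 by rewrite exprn_gt0.
  apply: (@le_trans _ _ (t * r * ((3 * (t * t)) / (k ^+ 4 * t ^+ 4)))).
    rewrite ler_wpM2l//; first by rewrite mulr_ge0// ltW.
    have xt2 : x * x <= t * t by apply: ler_pM => //; exact: ltW.
    have x2 : 1 <= x * x by nra.
    rewrite ler_wpM2r//; last by lra.
    by rewrite invr_ge0 mulr_ge0// ltW// exprn_gt0.
  have -> : t * r * ((3 * (t * t)) / (k ^+ 4 * t ^+ 4)) = (3 * r / k ^+ 4) * t^-1.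
    by field; rewrite (gt_eqF k0) (gt_eqF t0).
  rewrite ler_wpM2l//; last by rewrite lef_pV2.
  by rewrite divr_ge0// ?mulr_ge0// ltW.
apply: (@le_trans _ _ ((2 * x) * r * (2 / (x * x / 2)))).
  rewrite ler_pM//.
  - by rewrite mulr_ge0// ltW.
  - by rewrite divr_ge0// ltW.
  - by rewrite ler_wpM2r.
  - by rewrite ler_wpM2l// lef_pV2 ?posrE//; nra.
by rewrite le_eqVlt; apply/orP; left; apply/eqP; field; rewrite gt_eqF.
Unshelve. all: by end_near.
Qed.

End cotangent_limit.

(** * Legendre's relation *)

(* [tele (z - 1/2) - tele (z + 1/2) = z ^- 2 + O(z ^- 6)]: the first two terms of the
   Euler-Maclaurin expansion. *)
Definition tele (R : realType) (z : R[i]) : R[i] := z^-1 - z ^- 3 / 12.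

(** At the origin [0 ^- 2] is 0, and the value is 2 tele(1/2) = 8/3: the telescoping part puts there
    most of the sum pi^2/3 of the row m = 0. *)
Definition rem2 (R : realType) (z : R[i]) : R[i] :=
  z ^- 2 - (tele (z - 2^-1) - tele (z + 2^-1)).

Section remainder.
Variable R : realType.
Implicit Type z : R[i].

(** The closed form makes the decay of order z^-6 visible. *)
Lemma rem2E z : z != 0 -> z ^+ 2 - 4^-1 != 0 ->
  rem2 z = (7 / 48 * z ^+ 2 - 64^-1) / (z ^+ 2 * (z ^+ 2 - 4^-1) ^+ 3).
Proof.
move=> z0 s0; have sE : z ^+ 2 - 4^-1 = (z - 2^-1) * (z + 2^-1) by field.
have [a0 b0] : z - 2^-1 != 0 /\ z + 2^-1 != 0.
  by apply/andP; rewrite -negb_or -mulf_eq0 -sE.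
have -> : rem2 z = (z ^+ 2)^-1 - (z ^+ 2 - 4^-1)^-1 +
    (3 * z ^+ 2 + 4^-1) / (12 * (z ^+ 2 - 4^-1) ^+ 3).
  have e1 : (z - 2^-1)^-1 - (z + 2^-1)^-1 = (z ^+ 2 - 4^-1)^-1.
    rewrite sE; move: a0 b0; set a := z - 2^-1; set b := z + 2^-1 => a0 b0.
    have ab : b - a = 1 by rewrite /a /b; field.
    by apply: (mulIf (mulf_neq0 a0 b0)); rewrite mulVf ?mulf_neq0// -ab; clearbody a
        b; field; rewrite a0 b0.
  have e3 : (z - 2^-1) ^- 3 - (z + 2^-1) ^- 3 = (3 * z ^+ 2 + 4^-1) / (z ^+ 2 - 4^-1)
      ^+ 3.
    have -> : 3 * z ^+ 2 + 4^-1 = (z + 2^-1) ^+ 3 - (z - 2^-1) ^+ 3 by field.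
    rewrite sE; move: a0 b0; move: (z - 2^-1) (z + 2^-1) => a b a0 b0.
    by field; rewrite a0 b0.
  have -> : rem2 z = (z ^+ 2)^-1 - ((z - 2^-1)^-1 - (z + 2^-1)^-1) +
      12^-1 * ((z - 2^-1) ^- 3 - (z + 2^-1) ^- 3).
    rewrite /rem2 /tele.
    move: (z ^- 2) ((z - 2^-1) ^- 3) ((z + 2^-1) ^- 3) ((z - 2^-1)^-1) ((z +
        2^-1)^-1) => q a3 b3 a b.
    by field.
  by rewrite e1 e3 [(12 * _)^-1]invfM [12^-1 * (_ / _)]mulrCA.
have q0 : z ^+ 2 != 0 by rewrite expf_neq0.
clear sE a0 b0; move: (z ^+ 2) q0 s0 => q q0 s0.
have -> : 7 / 48 * q - 64^-1 = (q - 4^-1) ^+ 3 - q * (q - 4^-1) ^+ 2 + q * (3 * q +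
    4^-1) / 12 by field.
by move: (q - 4^-1) s0 => s s0; field; rewrite q0 s0.
Qed.

(** The parameter s is whatever lower bound for |z|^2 is at hand; the constant decreases to 7/48 as
    s grows. The values 1, 2, 5/2 and 4 are used below. *)
Lemma nrm_rem2_le z (s : R) : 1 <= s -> s <= nrm z ^+ 2 ->
  nrm (rem2 z) <= (7 / 48 + (64 * s)^-1) / (1 - (4 * s)^-1) ^+ 3 / (nrm z ^+ 2) ^+ 3.
Proof.
move=> s1 sz; have s0 : 0 < s by lra.
have is1 : s^-1 <= 1 by rewrite invf_le1.
have is0 : 0 < s^-1 by rewrite invr_gt0.
have z0 : z != 0.
  by apply: contraTneq sz => ->; rewrite nrm0 expr0n -ltNge.
set c := 1 - (4 * s)^-1; have c0 : 0 < c by rewrite /c invfM; lra.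
have q0 : 0 < nrm z ^+ 2 by lra.
have cq : nrm z ^+ 2 * c <= nrm (z ^+ 2 - 4^-1).
  have := nrm_rev (z ^+ 2) (4^-1); rewrite nrmX nrmV nrm_nat.
  have : nrm z ^+ 2 * (4 * s)^-1 >= 4^-1.
    by rewrite invfM mulrCA ler_peMr// ler_pdivlMr// mul1r.
  by rewrite /c mulrBr mulr1; lra.
have v0 : 0 < nrm (z ^+ 2 - 4^-1) by apply: lt_le_trans cq; rewrite mulr_gt0.
rewrite rem2E// -?nrm_gt0// nrmM nrmV nrmM !nrmX.
have num : nrm (7 / 48 * z ^+ 2 - 64^-1) <= (7 / 48 + (64 * s)^-1) * nrm z ^+ 2.
  have n748 : nrm (7 / 48 : R[i]) = 7 / 48 by rewrite nrmM nrmV !nrm_nat.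
  rewrite (le_trans (nrmB _ _))// [nrm (_ * _)]nrmM n748 nrmX nrmV nrm_nat
      [leRHS]mulrDl lerD//.
  by rewrite invfM -mulrA ler_peMr// mulrC ler_pdivlMr// mul1r.
move: (nrm z ^+ 2) (nrm (z ^+ 2 - 4^-1)) (7 / 48 + (64 * s)^-1) q0 v0 cq num => q v k
    q0 v0 cq num.
have -> : k / c ^+ 3 / q ^+ 3 = k * q / (q * (q * c) ^+ 3).
  by field; rewrite (gt_eqF c0) (gt_eqF q0).
have qc0 : 0 < q * c by rewrite mulr_gt0.
apply: ler_pM => //; first exact: nrm_ge0.
  by rewrite invr_ge0 ltW// mulr_gt0 ?exprn_gt0.
rewrite lef_pV2 ?posrE ?mulr_gt0 ?exprn_gt0// ler_pM2l//.
by rewrite lerXn2r// nnegrE ltW.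
Qed.

Lemma nrm_tele_le z : 1 <= nrm z -> nrm (tele z) <= 2 / nrm z.
Proof.
move=> z1; have z0 : 0 < nrm z by lra.
rewrite (le_trans (nrmB _ _))// nrmM !nrmV !nrmX nrm_nat.
have : (nrm z ^+ 3)^-1 <= (nrm z)^-1.
  rewrite lef_pV2 ?posrE ?exprn_gt0// -[leLHS]expr1.
  exact: ler_weXn2l.
have : 0 < (nrm z)^-1 by rewrite invr_gt0.
by lra.
Qed.

Lemma teleN z : tele (- z) = - tele z.
Proof. by rewrite /tele exprNn -signr_odd/= expr1 mulN1r !invrN; ring. Qed.

(** This is the absolute convergence that the series of z^-2 lacks: rows first and columns first
    give the same H, so the two orders for z^-2 differ by telescoping parts alone. *)
Lemma rem2_sum (w1 w2 : R[i]) : discrete_basis w1 w2 -> exists H : R[i],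
  forall a b : nat -> nat, a @ \oo --> \oo -> b @ \oo --> \oo ->
  clim (fun K => \sum_(m <- irange (a K)) \sum_(n <- irange (b K))
    rem2 (lpt w1 w2 m n)) H.
Proof.
move=> basis; have [c c0 cP] := basis.
pose f : R[i] -> R[i]^o := patch (fun=> 0) (lattice w1 w2) (@rem2 R).
pose K0 := Num.bound c^-1.
have K0c : c^-1 < K0%:R by rewrite archi_boundP// invr_ge0 ltW.
have [|m n mn|H [_ HP]] := @lattice_sum R w1 w2 basis f (c ^- 3) K0.
- by move=> z Lz; rewrite /f /patch memNset.
- rewrite /f /patch mem_set; last exact: lattice_lpt.
  set z := lpt w1 w2 m n.
  have s0 : c^-1 < (absz m + absz n)%N%:R.
    by apply: lt_le_trans K0c _; rewrite ler_nat; lia.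
  have zs := cP m n; rewrite -/z in zs; move: (_%:R : R) s0 zs => s s0 zs.
  have cs : 1 < c * s by rewrite mulrC -ltr_pdivrMr// div1r.
  have z1 : 1 <= nrm z by lra.
  have /(nrm_rem2_le (lexx 1)) : 1 <= nrm z ^+ 2 by rewrite exprn_ege1.
  move=> /le_trans; apply.
  have p3 : 0 < nrm z ^+ 3 by rewrite exprn_gt0//; lra.
  apply: (@le_trans _ _ (nrm z ^+ 3)^-1).
    have -> : (nrm z ^+ 2) ^+ 3 = nrm z ^+ 3 * nrm z ^+ 3 by rewrite -exprM -exprD.
    rewrite [(nrm z ^+ 3 * _)^-1]invfM mulrA ler_piMl//.
      by rewrite invr_ge0 ltW.
    rewrite ler_pdivrMr// mul1r; apply: (@le_trans _ _ 1); last exact: exprn_ege1.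
    by rewrite !mulr1 ler_pdivrMr; lra.
  have s00 : 0 < s by apply: lt_trans s0; rewrite invr_gt0.
  rewrite -invfM -exprMn lef_pV2 ?posrE// ?exprn_gt0 ?mulr_gt0//.
  by rewrite lerXn2r ?nnegrE ?nrm_ge0// mulr_ge0// ltW.
exists H => a b aoo boo; have := HP a b aoo boo.
congr clim; apply/funext => K; apply: eq_bigr => m _; apply: eq_bigr => n _.
by rewrite /f /patch mem_set//; exact: lattice_lpt.
Qed.

Lemma rem2_row (z : R[i]) L : \sum_(n <- irange L) (z + n%:~R) ^- 2 =
  \sum_(n <- irange L) rem2 (z + n%:~R) +
  (tele (z - (L%:R + 2^-1)) - tele (z + (L%:R + 2^-1))).
Proof.
have := irange_telescope L (fun n : int => tele (z + n%:~R - 2^-1)).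
rewrite rmorphN rmorphD/= -!pmulrn.
have -> : z + (L%:R + 1) - 2^-1 = z + (L%:R + 2^-1) by field.
have -> : z - L%:R - 2^-1 = z - (L%:R + 2^-1) by field.
move=> <-; rewrite -big_split; apply: eq_bigr => n _ /=; rewrite /rem2.
have -> : z + (n + 1)%:~R - 2^-1 = z + n%:~R + 2^-1 by rewrite rmorphD/=; field.
by rewrite subrK.
Qed.

End remainder.

Definition imag (R : realType) : R[i] := 0 +i* 1.

Section legendre.
Variable R : realType.
Implicit Type tau : R[i].

Let half : nat -> R := fun K => K%:R + 2^-1.

Let halfE K : (half K)%:C = K%:R + 2^-1 :> R[i].
Proof. by rewrite /half rmorphD fmorphV !rmorph_nat. Qed.

Let archi_near (x : R) : \forall K \near \oo, x <= K%:R.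
Proof.
near=> K; apply: (@le_trans _ _ (Num.bound `|x|)%:R).
  by rewrite (le_trans (ler_norm _))// ltW// archi_boundP.
by rewrite ler_nat; near: K; exact: nbhs_infty_ge.
Unshelve. all: by end_near.
Qed.

Section at_tau.
Variables (tau : R[i]) (tau_upper : 0 < complex.Im tau).
Let basis := discrete_basis_upper tau_upper.

Let row_far : exists2 c : R, 0 < c & forall (m : int) (L : nat), 1 <= c * L%:R ->
  c * L%:R <= nrm (m%:~R * tau + (L%:R + 2^-1)) /\
  c * L%:R <= nrm (m%:~R * tau - (L%:R + 2^-1)).
Proof.
(* Halving the constant pays for the shift by 1/2 once c L / 2 >= 1. *)
have [c c0 cP] := basis; exists (c / 2); first by rewrite divr_gt0.
move=> m L cL.
have h2 : nrm (2 : R[i])^-1 = 2^-1 by rewrite nrmV nrm_nat.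
have far (n : int) : absz n = L -> c * L%:R <= nrm (m%:~R * tau + n%:~R).
  move=> nL; have := cP m n; rewrite /lpt mulr1 => /(le_trans _); apply.
  by rewrite ler_pM2l// ler_nat nL leq_addl.
split.
- have -> : m%:~R * tau + (L%:R + 2^-1) = (m%:~R * tau + (L%:Z)%:~R) - (- 2^-1).
    by rewrite -pmulrn; ring.
  apply: le_trans (nrm_rev _ _); rewrite nrmN h2.
  by have := far L%:Z erefl; lra.
- have -> : m%:~R * tau - (L%:R + 2^-1) = (m%:~R * tau + (- L%:Z)%:~R) - 2^-1.
    by rewrite rmorphN/= -pmulrn; ring.
  apply: le_trans (nrm_rev _ _); rewrite h2.
  by have := far (- L%:Z) (abszN _); lra.
Qed.

(** Along long rows the ends lie at distance of order K^2, so the 2K + 1 differences of [tele]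
    vanish in the limit and G is the sum of the remainders. *)
Lemma eisenstein2_rem2 : exists2 G, eisenstein2 tau 1 G &
  forall a b : nat -> nat, a @ \oo --> \oo -> b @ \oo --> \oo ->
  clim (fun K => \sum_(m <- irange (a K)) \sum_(n <- irange (b K))
    rem2 (lpt tau 1 m n)) G.
Proof.
have [H HP] := rem2_sum basis; exists H => //.
have [c c0 far] := row_far.
rewrite /eisenstein2 -[H]addr0.
pose D K := \sum_(m <- irange K) (tele (m%:~R * tau - ((K * K)%:R + 2^-1)) -
  tele (m%:~R * tau + ((K * K)%:R + 2^-1))).
have -> : (fun K => \sum_(m <- irange K) \sum_(n <- irange (K * K)) lpt tau 1 m n ^-
    2) =
    (fun K => \sum_(m <- irange K) \sum_(n <- irange (K * K)) rem2 (lpt tau 1 m n) +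
        D K).
  apply/funext => K; rewrite -big_split; apply: eq_bigr => m _ /=.
  rewrite /lpt; under eq_bigr do rewrite mulr1.
  by rewrite rem2_row; congr (_ + _); apply: eq_bigr => n _; rewrite mulr1.
apply: climD; first exact: HP cvg_id cvg_sqn.
apply: (@clim_inv _ _ _ (12 / c)); near=> K; rewrite subr0.
have K1 : 1 <= K%:R :> R by near: K; exact: archi_near.
have Kc : c^-1 <= K%:R by near: K; exact: archi_near.
have cK : 1 <= c * K%:R by rewrite mulrC -ler_pdivrMr// div1r.
have cKK : 1 <= c * (K * K)%:R by rewrite natrM mulrA; nra.
have e : K.*2.+1%:R = 2 * K%:R + 1 :> R by rewrite -natrM natr1 mul2n.
apply: (@le_trans _ _ (4 / (c * (K * K)%:R) * K.*2.+1%:R)).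
  rewrite (le_trans (nrm_sum _ _ _))//; apply: irange_sum_le => m _.
  have [f1 f2] := far m _ cKK.
  have bd z : c * (K * K)%:R <= nrm z -> nrm (tele z) <= 2 / (c * (K * K)%:R).
    move=> h; have z1 : 1 <= nrm z by exact: le_trans h.
    rewrite (le_trans (nrm_tele_le z1))// ler_wpM2l// lef_pV2 ?posrE//; lra.
  by rewrite (le_trans (nrmB _ _))//; have := bd _ f1; have := bd _ f2; lra.
rewrite e natrM; move: (K%:R : R) K1 => k k1.
have k0 : 0 < k by lra.
have -> : 4 / (c * (k * k)) * (2 * k + 1) = (4 / c / k) * ((2 * k + 1) / k).
  by field; rewrite (gt_eqF c0) (gt_eqF k0).
have -> : 12 / c / k = (4 / c / k) * 3 by ring.
by rewrite ler_pM2l ?divr_gt0// ler_pdivrMr//; lra.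
Unshelve. all: by end_near.
Qed.

(** G' sums the same array with long columns. Read by rows, these have length of order K and there
    are 2 K^2 + 1 of them, too many for their ends at distance K + 1/2 to be negligible. The part
    1/z of [tele] at these ends forms the cotangent sum. *)
Lemma legendre_clim G G' : eisenstein2 tau 1 G -> eisenstein2 1 tau G' ->
  clim (fun K => 2 * cotangent_sum (K * K) ((half K)%:C * tau^-1)) (tau * (G - G')).
Proof.
have [H GH HP] := eisenstein2_rem2; move=> /(clim_unique GH) <- {G GH} G'P.
have tau0 : tau != 0 by apply: contraTneq tau_upper => ->; rewrite ltxx.
have [c c0 far] := row_far.
have T : clim (fun K => 2 * \sum_(m <- irange (K * K)) tele (m%:~R * tau + (K%:R +
    2^-1)))
    (H - G').
  have := climB (HP _ _ cvg_sqn cvg_id) G'P; congr clim; apply/funext => K.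
  have -> : \sum_(m <- irange K) \sum_(n <- irange (K * K)) lpt 1 tau m n ^- 2 =
      \sum_(m <- irange (K * K)) (\sum_(n <- irange K) rem2 (lpt tau 1 m n) +
        (tele (m%:~R * tau - (K%:R + 2^-1)) - tele (m%:~R * tau + (K%:R + 2^-1)))).
    rewrite exchange_big; apply: eq_bigr => m _ /=; rewrite /lpt.
    under eq_bigr do rewrite mulr1 addrC.
    by rewrite rem2_row; congr (_ + _); apply: eq_bigr => n _; rewrite mulr1.
  rewrite big_split/= opprD addrA subrr add0r sumrB.
  have -> : \sum_(m <- irange (K * K)) tele (m%:~R * tau - (K%:R + 2^-1)) =
      - \sum_(m <- irange (K * K)) tele (m%:~R * tau + (K%:R + 2^-1)).
    rewrite -irange_opp -sumrN; apply: eq_bigr => m _.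
    by rewrite rmorphN/= mulNr -opprD teleN.
  by ring.
rewrite -(subr0 (tau * (H - G'))).
(* The part z^-3/12 of [tele], doubled and multiplied by tau; its sum is O(K^2 / K^3). *)
pose D K := \sum_(m <- irange (K * K)) (6^-1 * tau * (m%:~R * tau + (K%:R + 2^-1)) ^-
    3).
have -> : (fun K => 2 * cotangent_sum (K * K) ((half K)%:C * tau^-1)) = (fun K =>
    tau * (2 * \sum_(m <- irange (K * K)) tele (m%:~R * tau + (K%:R + 2^-1))) - - D K).
  apply/funext => K; rewrite opprK mulrCA !mulr_sumr -big_split; apply: eq_bigr => m
      _ /=.
  have -> : (half K)%:C * tau^-1 + m%:~R = (m%:~R * tau + (K%:R + 2^-1)) / tau.
    by rewrite halfE; field.
  rewrite invfM invrK /tele; move: (_ + _) => z; move: (z^-1) (z ^- 3) => a b.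
  by field.
apply: climB; first exact: climZ.
apply: (@clim_inv _ _ _ (nrm tau / c ^+ 3)); near=> K; rewrite subr0 nrmN.
have K1 : 1 <= K%:R :> R by near: K; exact: archi_near.
have Kc : c^-1 <= K%:R by near: K; exact: archi_near.
have cK : 1 <= c * K%:R by rewrite mulrC -ler_pdivrMr// div1r.
have e : (K * K).*2.+1%:R = 2 * (K%:R * K%:R) + 1 :> R by rewrite -!natrM natr1 mul2n.
apply: (@le_trans _ _ (6^-1 * nrm tau * (c * K%:R) ^- 3 * (K * K).*2.+1%:R)).
  rewrite (le_trans (nrm_sum _ _ _))//; apply: irange_sum_le => m _.
  have [f1 _] := far m _ cK.
  rewrite 2!nrmM !nrmV nrm_nat nrmX ler_wpM2l ?mulr_ge0 ?nrm_ge0//.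
  rewrite lef_pV2 ?posrE ?exprn_gt0//; [|lra|lra].
  by rewrite lerXn2r ?nnegrE ?nrm_ge0//; lra.
rewrite e; move: (K%:R : R) K1 => k k1; have k0 : 0 < k by lra.
have -> : 6^-1 * nrm tau * (c * k) ^- 3 * (2 * (k * k) + 1) =
    (nrm tau / c ^+ 3 / k) * ((2 * (k * k) + 1) / (6 * (k * k))).
  by field; rewrite (gt_eqF c0) (gt_eqF k0).
apply: ler_piMr.
  have k0' := ltW k0; have c0' := ltW c0.
  by rewrite !divr_ge0 ?nrm_ge0 ?exprn_ge0.
by rewrite ler_pdivrMr ?mulr_gt0//; nra.
Unshelve. all: by end_near.
Qed.

End at_tau.

Local Notation I := (imag R).

Lemma sqr_imag : I ^+ 2 = -1. Proof. exact: sqr_i. Qed.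

(** Multiplication by i preserves the square lattice, exchanges rows with columns and negates
    squares. Hence Legendre's constant at i is i (L - (-L)) = 2 i L. *)
Lemma eisenstein2_swap_i (G : R[i]) : eisenstein2 I 1 G -> eisenstein2 1 I (- G).
Proof.
move=> /climN; congr clim; apply/funext => K.
rewrite -(irange_opp K (fun m => \sum_(n <- irange (K * K)) lpt I 1 m n ^- 2)).
rewrite -sumrN; apply: eq_bigr => m _; rewrite -sumrN; apply: eq_bigr => n _.
have -> : lpt 1 I m n = I * lpt I 1 (- m) n.
  rewrite /lpt mulrNz mulrDr !mulr1 mulrCA -expr2 sqr_imag; ring.
by rewrite exprMn sqr_imag mulN1r invrN.
Qed.

(* Legendre's relation [eta_1 tau - eta_2 = 2 pi i], with pi in the guise of the
   value at [tau = i] of the Eisenstein series [G_2]. *)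
Lemma legendre tau G L : 0 < complex.Im tau ->
  eisenstein2 tau 1 G -> eisenstein2 I 1 L ->
  quasi_period tau 1 1 = G /\ quasi_period tau 1 tau = tau * G - 2 * I * L.
Proof.
move=> tau_upper GP LP.
have i_upper : 0 < complex.Im I by exact: ltr01.
have basis := discrete_basis_upper tau_upper.
split; first by rewrite (quasi_period_eisenstein2 basis GP) mul1r.
have basis' := discrete_basis_swap basis.
have [G' GP' _] := eisenstein2_quasi_period basis'.
rewrite (quasi_period_lattice (lattice_swap tau 1)).
rewrite (quasi_period_eisenstein2 basis' GP').
(* Both tau (G - G') and 2 i L are limits of cotangent sums, along the rays through 1/tau and 1/i in
   the lower half-plane; these sums approach each other. *)
have l1 := legendre_clim tau_upper GP GP'.
have l2 := legendre_clim i_upper LP (eisenstein2_swap_i LP).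
have Im_inv z : 0 < complex.Im z -> complex.Im (z^-1 : R[i]) < 0.
  case: z => x y /= y0; rewrite oppr_lt0 divr_gt0// ltr_wpDl ?sqr_ge0// exprn_gt0//.
have := climZ 2 (cotangent_sum_clim (Im_inv _ tau_upper) (Im_inv _ i_upper)).
have := climB l1 l2.
under [X in clim X]eq_fun do rewrite -mulrBr.
move=> /clim_unique /[apply]; rewrite mulr0 => /eqP; rewrite subr_eq0 => /eqP e.
have -> : tau * G' = tau * G - tau * (G - G') by ring.
by rewrite e; ring.
Qed.

End legendre.

(** * Explicit bounds *)

Section numerics.
Variable R : realType.
Local Notation I := (imag R).

(* Since [0^-1 = 0], [c3 0 = 0], and [c3] can be summed over the whole range. *)
Let c3 (m : int) : R := (absz m)%:R ^- 3.

Let c3_ge0 m : 0 <= c3 m. Proof. by rewrite invr_ge0 exprn_ge0. Qed.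

Let c3_sum K : \sum_(m <- irange K) c3 m <= 5 / 2.
Proof.
case: K => [|K]; first by rewrite big_seq1 /c3 expr0n invr0 divr_ge0.
(* The full sum is 2 zeta(3), about 2.40. The correction telescopes, as 2/(k + 1)^3 <= 2/(k (k + 1)
   (k + 2)), and gives equality at the first step. *)
apply: (@le_trans _ _ (5 / 2 - (K.+1%:R * K.+2%:R)^-1)); last first.
  by rewrite gerBl invr_ge0 mulr_ge0.
elim: K => [|K IH].
  rewrite irange_sumS big_seq1 /c3 /= expr0n invr0 expr1n invr1; lra.
rewrite irange_sumS (le_trans (lerD (lexx _) IH))// /c3 abszN /=.
rewrite -[K.+3%:R]natr1 -[K.+2%:R]natr1; move: (ltr0Sn R K); move: (K.+1%:R : R) => k
    k0.
have k1 : 0 < k + 1 by lra.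
have k2 : 0 < k + 1 + 1 by lra.
suff : (k + 1) ^- 3 + (k + 1) ^- 3 <= (k * (k + 1))^-1 - ((k + 1) * (k + 1 + 1))^-1
    by lra.
have -> : (k * (k + 1))^-1 - ((k + 1) * (k + 1 + 1))^-1 =
    2 / ((k + 1) * (k * (k + 1 + 1))).
  by field; rewrite !gt_eqF//; lra.
have -> : (k + 1) ^- 3 + (k + 1) ^- 3 = 2 / (k + 1) ^+ 3 by ring.
rewrite ler_wpM2l// lef_pV2 ?posrE ?mulr_gt0 ?exprn_gt0// exprS ler_pM2l//; nra.
Qed.

Let rest (K : nat) (F : int -> int -> R[i]) : R[i] :=
  \sum_(m <- irange K | m != 0) \sum_(n <- irange K) F m n.

(** A majorant of product form lets the double sum factor. As [c3 0] is 0, the column n = 0 carries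
    its own constant b. *)
Let rest_le K F (a b : R) : 0 <= a -> 0 <= b ->
  (forall m n, m != 0 -> nrm (F m n) <= c3 m * (a * c3 n + b * (n == 0)%:R)) ->
  nrm (rest K F) <= 5 / 2 * (a * (5 / 2) + b).
Proof.
move=> a0 b0 FP.
have row m : m != 0 -> nrm (\sum_(n <- irange K) F m n) <= c3 m * (a * (5 / 2) + b).
  move=> m0; apply: (@le_trans _ _ (\sum_(n <- irange K) c3 m * (a * c3 n + b * (n ==
      0)%:R))).
    by rewrite (le_trans (nrm_sum _ _ _))//; apply: ler_sum => n _; exact: FP.
  rewrite -mulr_sumr ler_wpM2l// big_split/= -!mulr_sumr lerD//.
    by rewrite ler_wpM2l.
  by rewrite irange_sum0 ?eqxx ?mulr1// => n /negbTE ->.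
rewrite (le_trans (nrm_sum _ _ _))//.
apply: (@le_trans _ _ (\sum_(m <- irange K | m != 0) c3 m * (a * (5 / 2) + b))).
  exact: ler_sum.
rewrite -mulr_suml ler_wpM2r//; first by rewrite addr_ge0// mulr_ge0// divr_ge0.
apply: le_trans (c3_sum K).
by rewrite [leRHS](bigID (fun m : int => m != 0))/= lerDl sumr_ge0.
Qed.

Let row0 K : R[i] := \sum_(n <- irange K) rem2 (n%:~R).

Let box_rest K t : \sum_(m <- irange K) \sum_(n <- irange K) rem2 (lpt t 1 m n) =
  row0 K + rest K (fun m n => rem2 (lpt t 1 m n)).
Proof.
rewrite (bigD1_seq 0) ?uniq_irange ?mem_irange//=; congr (_ + _).
by apply: eq_bigr => n _; rewrite /lpt mul0r add0r mulr1.
Qed.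

Let rem2_int (n : int) : n != 0 -> (0 <= complex.Re (rem2 (n%:~R : R[i]))) /\
  (absz n = 1%N -> 3 / 10 <= complex.Re (rem2 (n%:~R : R[i]))).
Proof.
move=> n0; pose q : R := n%:~R ^+ 2.
have q1 : 1 <= q by rewrite /q -rmorphXn/= ler1z -gtz0_ge1 exprn_even_gt0.
have qE : (n%:~R : R[i]) ^+ 2 = q%:C by rewrite rmorphXn rmorph_int.
have qq : absz n = 1%N -> q = 1.
  rewrite /q => n1; have [->|->] : n = 1 \/ n = -1 by lia.
    by rewrite expr1n.
  by rewrite mulrNz sqrrN expr1n.
clearbody q.
have q4E : q%:C - 4^-1 = (q - 4^-1)%:C by rewrite rmorphB fmorphV rmorph_nat.
have -> : rem2 (n%:~R : R[i]) = ((7 / 48 * q - 64^-1) / (q * (q - 4^-1) ^+ 3))%:C.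
  rewrite rem2E ?intr_eq0// qE q4E; last by rewrite fmorph_eq0 gt_eqF//; lra.
  by rewrite !(rmorphM, rmorphB, rmorphXn, fmorphV, rmorph_nat).
have d0 : 0 < q * (q - 4^-1) ^+ 3 by rewrite mulr_gt0 ?exprn_gt0//; lra.
split=> [|n1] /=; first by rewrite divr_ge0 ?(ltW d0)//; lra.
by rewrite ler_pdivlMr// qq//; lra.
Qed.

Let rem2_0 : complex.Re (rem2 (0 : R[i])) = 8 / 3.
Proof.
have -> : rem2 0 = (8 / 3)%:C :> R[i]; last by [].
rewrite rmorphM fmorphV !rmorph_nat /rem2 expr0n invr0 !sub0r add0r teleN.
by rewrite /tele -exprVn invrK; field.
Qed.

(** The full row sums to pi^2/3, about 3.29. The terms 0, 1, -1 already give 8/3 + 6/10 > 13/4, and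
    the others have nonnegative real part. *)
Let row0_ge K : (0 < K)%N -> 13 / 4 <= nrm (row0 K).
Proof.
move=> K0; apply: le_trans (nrm_Re _); apply: le_trans (ler_norm _).
case: K K0 => // K _; elim: K => [|K IH].
  rewrite /row0 irange_sumS big_seq1 2!ReD mulr0z rem2_0.
  have [_ /(_ erefl) h1] := @rem2_int 1 isT.
  have [_ /(_ erefl) h2] := @rem2_int (-1) isT.
  lra.
rewrite /row0 irange_sumS 2!ReD.
have [h1 _] := @rem2_int K.+2 isT.
have [h2 _] := @rem2_int (- K.+2%:Z) isT.
by apply: le_trans IH _; rewrite lerDr addr_ge0.
Qed.

Let inv3_le (k p q : R) : 0 <= k -> 0 < p -> p <= q -> k / q ^+ 3 <= k / p ^+ 3.
Proof.
move=> k0 p0 pq; have q0 : 0 < q by apply: lt_le_trans pq.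
rewrite ler_wpM2l// lef_pV2 ?posrE ?exprn_gt0// lerXn2r// nnegrE ltW//.
Qed.

Let absz_ge1 (m : int) : m != 0 -> 1 <= (absz m)%:R :> R.
Proof. by move=> m0; rewrite ler1n; lia. Qed.

Let intr_sqr (m : int) : (m%:~R : R) ^+ 2 = (absz m)%:R ^+ 2.
Proof. by rewrite natr_absz intr_norm real_normK ?num_real. Qed.

Let sqr_nrm_lpt (t : R[i]) m n : nrm (lpt t 1 m n) ^+ 2 =
  (m%:~R * complex.Re t + n%:~R) ^+ 2 + (m%:~R * complex.Im t) ^+ 2.
Proof. by rewrite sqr_nrm Re_lpt1 Im_lpt1. Qed.

(** Off the axis, m^2 + n^2 >= 2 |m n| separates the variables, and the factor 8 from cubing is what
    makes 3/100 suffice. *)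
Let rem2_i m n : m != 0 -> nrm (rem2 (lpt I 1 m n)) <=
  c3 m * (3 / 100 * c3 n + 12^-1 * (n == 0)%:R).
Proof.
move=> m0; have a1 := absz_ge1 m0.
have qE : nrm (lpt I 1 m n) ^+ 2 = (absz m)%:R ^+ 2 + (absz n)%:R ^+ 2.
  by rewrite sqr_nrm_lpt/= mulr0 add0r mulr1 !intr_sqr addrC.
rewrite /c3; have [n0|n0] := eqVneq n 0; last first.
  have b1 := absz_ge1 n0; rewrite mulr0 addr0.
  move: (absz m)%:R (absz n)%:R qE a1 b1 => a b qE a1 b1.
  have ab : 2 * (a * b) <= a ^+ 2 + b ^+ 2 by have := sqr_ge0 (a - b); rewrite sqrrB;
      lra.
  have ab1 : 1 <= a * b by nra.
  have ab0 : 0 < a * b by lra.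
  have q2 : 2 <= nrm (lpt I 1 m n) ^+ 2 by rewrite qE; lra.
  apply: (le_trans (@nrm_rem2_le _ _ 2 _ q2)); first by lra.
  rewrite qE; apply: le_trans (inv3_le _ _ ab) _.
  - by rewrite divr_ge0 ?exprn_ge0//; lra.
  - by lra.
  have -> : a ^- 3 * (3 / 100 * b ^- 3) = (8 * (3 / 100)) / (2 * (a * b)) ^+ 3.
    by field; rewrite !gt_eqF//; lra.
  rewrite ler_wpM2r//; first by rewrite invr_ge0 exprn_ge0//; lra.
  by rewrite ler_pdivrMr; lra.
rewrite n0 /= expr0n invr0 mulr0 add0r mulr1.
(* At i and -i the general estimate is too weak; the exact value -31/375 is just below 1/12 in
   modulus. *)
have [m1|m1] := eqVneq (absz m) 1%N.
  rewrite m1 expr1n invr1 mul1r.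
  have zE : lpt I 1 m 0 ^+ 2 = -1.
    rewrite /lpt mul0r addr0 exprMn sqr_imag.
    have [->|->] : m = 1 \/ m = -1 by lia.
      by rewrite expr1n mul1r.
    by rewrite mulrNz sqrrN expr1n mul1r.
  have -> : rem2 (lpt I 1 m 0) = ((7 / 48 * (-1) - 64^-1) / (-1 * (-1 - 4^-1) ^+ 3))%:C.
    have s4 : -1 - 4^-1 = (-1 - 4^-1)%:C :> R[i] by rewrite rmorphB rmorphN fmorphV
        rmorph_nat.
    rewrite rem2E ?zE.
    - by rewrite !(rmorphM, rmorphB, rmorphXn, fmorphV, rmorph_nat, rmorphN).
    - by rewrite -sqrf_eq0 zE oppr_eq0 oner_eq0.
    - by rewrite s4 fmorph_eq0 lt_eqF//; lra.
  have -> : (7 / 48 * (-1) - 64^-1) / (-1 * (-1 - 4^-1) ^+ 3) = - (31 / 375) :> R by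
      field.
  by rewrite nrm_real normrN ger0_norm; lra.
have a2 : 2 <= (absz m)%:R :> R by rewrite ler_nat; lia.
rewrite n0 in qE; rewrite expr0n addr0 in qE.
move: (absz m)%:R qE a1 a2 => a qE a1 a2.
have q4 : 4 <= nrm (lpt I 1 m 0) ^+ 2 by rewrite qE; nra.
apply: (le_trans (@nrm_rem2_le _ _ 4 _ q4)); first by lra.
have a3 : 2 * a <= a ^+ 2 by nra.
rewrite qE; apply: le_trans (inv3_le _ _ a3) _.
- by rewrite divr_ge0 ?exprn_ge0//; lra.
- by lra.
have -> : a ^- 3 * (12^-1) = (8 * (12^-1)) / (2 * a) ^+ 3.
  by field; rewrite !gt_eqF//; lra.
rewrite ler_wpM2r//; first by rewrite invr_ge0 exprn_ge0//; lra.
by rewrite ler_pdivrMr; lra.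
Qed.

(** A lower bound for |m t + n|^2 on the disc, in product form so that its cube separates m from
    n. *)
Let P (m n : int) : R := 12 / 5 * ((absz m)%:R * if n == 0 then 1 else (absz n)%:R).

Let P_gt0 m n : m != 0 -> 0 < P m n.
Proof.
move=> /absz_ge1 a1; rewrite mulr_gt0// mulr_gt0//; first by lra.
by case: eqVneq => // /absz_ge1; lra.
Qed.

Let P_cube (k : R) m n : m != 0 -> k / P m n ^+ 3 =
  c3 m * (k * (5 / 12) ^+ 3 * c3 n + k * (5 / 12) ^+ 3 * (n == 0)%:R).
Proof.
move=> /absz_ge1 a1; rewrite /P /c3; move: (absz m)%:R a1 => a a1.
case: eqVneq => [->|/absz_ge1].
  by rewrite absz0 expr0n invr0 /= mulr1 mulr0 add0r; field; rewrite gt_eqF//; lra.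
rewrite /= mulr0 addr0; move: (absz n)%:R => b b1.
by field; rewrite !gt_eqF//; lra.
Qed.

(** On the disc Im t >= 8/5 and |Re t| <= 2/5. Hence |m t + n|^2 >= (8/5)^2 m^2 + n^2 - 4/5 |m n|,
    which is at least (16/5 - 4/5) |m n| = 12/5 |m n|; for n = 0 use 64/25 > 12/5. *)
Let ball_lower t m n : nrm (t - 2 * I) <= 2 / 5 -> m != 0 ->
  8 / 5 * (absz m)%:R <= nrm (lpt t 1 m n) /\ P m n <= nrm (lpt t 1 m n) ^+ 2.
Proof.
move=> tb m0; have a1 := absz_ge1 m0.
have tE : nrm (t - 2 * I) ^+ 2 = complex.Re t ^+ 2 + (complex.Im t - 2) ^+ 2.
  have -> : 2 * I = 0 +i* 2 :> R[i].
    by rewrite -(rmorph_nat (real_complex R)) /imag /=; congr (_ +i* _); rewrite /=;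
        ring.
  by rewrite sqr_nrm ReD ImD /= subr0.
have tb2 : complex.Re t ^+ 2 + (complex.Im t - 2) ^+ 2 <= 4 / 25.
  rewrite -tE (_ : 4 / 25 = (2 / 5) ^+ 2); last by field.
  by rewrite lerXn2r ?nnegrE ?nrm_ge0//; lra.
have qE := sqr_nrm_lpt t m n.
move: (complex.Re t) (complex.Im t) tb2 qE => x y tb2 qE.
have sq (v : R) : v ^+ 2 <= 4 / 25 -> - (2 / 5) <= v /\ v <= 2 / 5.
  move=> v2; apply/andP; rewrite -ler_norml -(@ler_pXn2r _ 2)// ?nnegrE ?divr_ge0//.
  by rewrite real_normK ?num_real//; lra.
have [x1 x2] : - (2 / 5) <= x /\ x <= 2 / 5 by apply: sq; have := sqr_ge0 (y - 2); lra.
have [y1 _] : - (2 / 5) <= y - 2 /\ y - 2 <= 2 / 5 by apply: sq; have := sqr_ge0 x; lra.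
have {}y1 : 8 / 5 <= y by lra.
have mm : (m%:~R : R) ^+ 2 = (absz m)%:R ^+ 2 := intr_sqr m.
have nn : (n%:~R : R) ^+ 2 = (absz n)%:R ^+ 2 := intr_sqr n.
have mn : `|m%:~R * n%:~R : R| = (absz m)%:R * (absz n)%:R.
  by rewrite normrM -!intr_norm -!natr_absz.
have z0 := nrm_ge0 (lpt t 1 m n).
rewrite /P; move: (absz m)%:R (absz n)%:R (nrm _) (m%:~R : R) (n%:~R : R) a1 qE mm nn
    mn z0.
move=> a b z u v a1 zE uu vv uvE z0.
have /ler_normlP[uv1 uv2] : `|u * v| <= a * b by rewrite uvE.
have ay : (8 / 5 * a) ^+ 2 <= (u * y) ^+ 2.
  by rewrite !exprMn uu mulrC ler_pM2l ?exprn_gt0//; nra.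
have az : (8 / 5 * a) ^+ 2 <= z ^+ 2 by rewrite zE; have := sqr_ge0 (u * x + v); lra.
split.
  by rewrite -(@ler_pXn2r _ 2)// nnegrE; lra.
case: eqP => _; first by rewrite mulr1; nra.
(* The sum of [h1] and [h2] bounds the cross term: u v x >= -2/5 a b. *)
have h1 : 0 <= (a * b - u * v) * (2 / 5 - x) by rewrite mulr_ge0//; lra.
have h2 : 0 <= (a * b + u * v) * (2 / 5 + x) by rewrite mulr_ge0//; lra.
have h3 := sqr_ge0 (8 / 5 * a - b).
have h4 := sqr_ge0 (u * x).
rewrite zE; move: ay vv h1 h2 h3 h4; rewrite !expr2; nra.
Qed.

(** Here |z|^2 >= 64/25 > 5/2, which gives the constant 21/100, and 21/100 (5/12)^3 < 1/65. *)
Let rem2_ball t m n : nrm (t - 2 * I) <= 2 / 5 -> m != 0 ->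
  nrm (rem2 (lpt t 1 m n)) <= c3 m * (65^-1 * c3 n + 65^-1 * (n == 0)%:R).
Proof.
move=> tb m0; have [az Pz] := ball_lower n tb m0; have a1 := absz_ge1 m0.
have z2 : 5 / 2 <= nrm (lpt t 1 m n) ^+ 2 by nra.
have k : (7 / 48 + (64 * (5 / 2))^-1) / (1 - (4 * (5 / 2))^-1) ^+ 3 <= 21 / 100 :> R.
  have -> : (64 * (5 / 2))^-1 = 160^-1 :> R by field.
  have -> : (4 * (5 / 2))^-1 = 10^-1 :> R by field.
  by rewrite ler_pdivrMr; lra.
apply: (le_trans (@nrm_rem2_le _ _ (5 / 2) _ z2)); first by lra.
apply: (@le_trans _ _ (21 / 100 / (nrm (lpt t 1 m n) ^+ 2) ^+ 3)).
  by rewrite ler_wpM2r// invr_ge0 exprn_ge0// sqr_ge0.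
apply: le_trans (inv3_le _ (P_gt0 _ m0) Pz) _; first by rewrite divr_ge0.
rewrite P_cube// ler_wpM2l// lerD// ler_wpM2r//; lra.
Qed.

Let diff_inv (a b : R[i]) : a != 0 -> b != 0 ->
  nrm (a^-1 - b^-1) = nrm (a - b) * nrm a^-1 * nrm b^-1.
Proof.
move=> a0 b0; rewrite (nrm_dist a) -!nrmM; congr nrm.
by field; rewrite a0 b0.
Qed.

(** With u = (z^2 - 1/4)^-1 and w = z^-2 the remainder is (7/48 - w/64) u^3, and differences of u
    and w replace a derivative. The factor |m| in z - z' = m (t - t') is cancelled by |u| |z| and
    |w| |z|, both O(1/|m|), so the decay p^-3 survives. *)
Let rem2_lip t t' m n : nrm (t - 2 * I) <= 2 / 5 -> nrm (t' - 2 * I) <= 2 / 5 ->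
  m != 0 -> nrm (rem2 (lpt t 1 m n) - rem2 (lpt t' 1 m n)) <=
  c3 m * (15^-1 * nrm (t - t') * c3 n + 15^-1 * nrm (t - t') * (n == 0)%:R).
Proof.
move=> tb tb' m0; have [az Pz] := ball_lower n tb m0; have [az' Pz'] := ball_lower n
    tb' m0.
have a1 := absz_ge1 m0; have P0 := P_gt0 n m0.
have P1 : 1 <= P m n.
  by rewrite /P; case: eqVneq => [_|/absz_ge1 b1]; nra.
set d := nrm (t - t'); have d0 : 0 <= d := nrm_ge0 _.
have zz' : nrm (lpt t 1 m n - lpt t' 1 m n) = (absz m)%:R * d.
  have -> : lpt t 1 m n - lpt t' 1 m n = m%:~R * (t - t') by rewrite /lpt; ring.
  by rewrite nrmM nrm_int.
have -> : c3 m * (15^-1 * d * c3 n + 15^-1 * d * (n == 0)%:R) = d * ((12 / 5) ^+ 3 *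
    (15^-1)) / P m n ^+ 3.
  by rewrite P_cube//; field.
move: (lpt t 1 m n) (lpt t' 1 m n) az Pz az' Pz' zz'.
move: (absz m)%:R (P m n) a1 P0 P1 => a p a1 p0 p1 z z' az pz az' pz' zz'.
have q0 (v : R[i]) : 8 / 5 * a <= nrm v -> 64 / 25 <= nrm v ^+ 2 by nra.
have lower (v : R[i]) : 8 / 5 * a <= nrm v -> 9 / 10 * nrm v ^+ 2 <= nrm (v ^+ 2 -
    4^-1).
  move=> /q0 h; have := nrm_rev (v ^+ 2) (4^-1); rewrite nrmX nrmV nrm_nat; lra.
have gt0 (v : R[i]) : 8 / 5 * a <= nrm v -> 0 < nrm v by lra.
pose u v : R[i] := (v ^+ 2 - 4^-1)^-1; pose w v : R[i] := (v ^+ 2)^-1.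
have nz v : 8 / 5 * a <= nrm v -> (v ^+ 2 - 4^-1 != 0) * (v != 0).
  move=> h; rewrite -!nrm_gt0; split; last exact: gt0.
  by have := lower v h; have := q0 v h; lra.
have remE v : 8 / 5 * a <= nrm v -> rem2 v = (7 / 48 - w v / 64) * u v ^+ 3.
  move=> h; rewrite rem2E ?nz// /u /w; have [s0 v0] := nz v h.
  move: (v ^+ 2 - 4^-1) s0 => s s0.
  by field; rewrite s0 v0.
have uz v : 8 / 5 * a <= nrm v -> p <= nrm v ^+ 2 ->
    nrm (u v) <= 10 / 9 / p /\ nrm (u v) * nrm v <= 25 / 36 / a.
  move=> h pv; have lv := lower v h; have v0 := gt0 v h.
  have v20 : 0 < nrm v ^+ 2 by rewrite exprn_gt0.
  rewrite /u nrmV; split.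
    have -> : 10 / 9 / p = (9 / 10 * p)^-1 by field; rewrite gt_eqF.
    by rewrite lef_pV2 ?posrE; lra.
  rewrite mulrC ler_pdivrMr; last by lra.
  rewrite mulrAC ler_pdivlMr; last by lra.
  nra.
have wz v : 8 / 5 * a <= nrm v -> p <= nrm v ^+ 2 ->
    nrm (w v) <= p^-1 /\ nrm (w v) * nrm v <= 5 / 8 / a.
  move=> h pv; have v0 := gt0 v h; rewrite /w nrmV nrmX; split.
    by rewrite lef_pV2 ?posrE ?exprn_gt0.
  have -> : (nrm v ^+ 2)^-1 * nrm v = (nrm v)^-1 by field; rewrite gt_eqF.
  have -> : 5 / 8 / a = (8 / 5 * a)^-1 by field; rewrite gt_eqF//; lra.
  by rewrite lef_pV2 ?posrE; lra.
pose c := p^-1; have c0 : 0 < c by rewrite invr_gt0.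
have a0 : 0 < a by lra.
have [uz1 uz2] := uz z az pz; have [uz1' uz2'] := uz z' az' pz'.
have [wz1 wz2] := wz z az pz; have [wz1' wz2'] := wz z' az' pz'.
rewrite -/c in uz1 uz1' wz1 wz1'.
(* Serves both u and w. In |z + z'| |x^-1| |x'^-1| each of z, z' is paired with its own inverse,
   which yields the 1/a that cancels |m|. *)
have chain (x x' : R[i]) (k l : R) : 0 <= k -> nrm (z ^+ 2 - z' ^+ 2) = nrm (x - x') ->
    x != 0 -> x' != 0 -> nrm x^-1 <= l * c -> nrm x'^-1 <= l * c ->
    nrm x^-1 * nrm z <= k / a -> nrm x'^-1 * nrm z' <= k / a ->
    nrm (x^-1 - x'^-1) <= d * (2 * k * l) * c.
  move=> k0 xx' x0 x0' h h' hz hz'; rewrite diff_inv// -xx' subr_sqr nrmM zz' -!mulrA.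
  have nx := nrm_ge0 x^-1; have nx' := nrm_ge0 x'^-1.
  have zz := nrmD z z'.
  have ka : 0 <= k / a by rewrite divr_ge0// ltW.
  apply: (@le_trans _ _ (a * (d * (2 * ((k / a) * (l * c)))))); last first.
    by rewrite le_eqVlt; apply/orP; left; apply/eqP; field; rewrite gt_eqF.
  rewrite ler_pM2l// ler_wpM2l//.
  apply: (@le_trans _ _ ((nrm z + nrm z') * (nrm x^-1 * nrm x'^-1))).
    by rewrite ler_wpM2r// mulr_ge0.
  have -> : (nrm z + nrm z') * (nrm x^-1 * nrm x'^-1) =
    (nrm x^-1 * nrm z) * nrm x'^-1 + (nrm x'^-1 * nrm z') * nrm x^-1 by ring.
  rewrite mulr_natl mulr2n lerD//; apply: ler_pM => //; by rewrite mulr_ge0// nrm_ge0.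
have du : nrm (u z - u z') <= d * (2 * (25 / 36) * (10 / 9)) * c.
  apply: chain => //; last 2 first.
  - by rewrite (nz z az).
  - by rewrite (nz z' az').
  - by congr nrm; ring.
have dw : nrm (w z - w z') <= d * (2 * (5 / 8) * 1) * c.
  apply: chain => //; rewrite ?mul1r// expf_neq0//.
  - by rewrite (nz z az).
  - by rewrite (nz z' az').
have w64 : nrm (w z) <= 25 / 64.
  rewrite /w nrmV nrmX (_ : 25 / 64 = (64 / 25)^-1); last by field.
  by rewrite lef_pV2 ?posrE ?exprn_gt0 ?(gt0 z)// ?q0//; lra.
rewrite remE// remE//; clearbody u w.
have -> : (7 / 48 - w z / 64) * u z ^+ 3 - (7 / 48 - w z' / 64) * u z' ^+ 3 =
  (u z - u z') * (u z ^+ 2 + u z * u z' + u z' ^+ 2) * (7 / 48 - w z / 64) -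
  u z' ^+ 3 * (w z - w z') / 64 by field.
have e1 : nrm (u z ^+ 2 + u z * u z' + u z' ^+ 2) <= 3 * (10 / 9 * c) ^+ 2.
  have h (x y : R[i]) : nrm x <= 10 / 9 * c -> nrm y <= 10 / 9 * c ->
      nrm (x * y) <= (10 / 9 * c) ^+ 2.
    by move=> hx hy; rewrite nrmM expr2; apply: ler_pM => //; exact: nrm_ge0.
  have := nrmD (u z ^+ 2 + u z * u z') (u z' ^+ 2).
  have := nrmD (u z ^+ 2) (u z * u z').
  have := h _ _ uz1 uz1; have := h _ _ uz1 uz1'; have := h _ _ uz1' uz1'.
  by rewrite -!expr2; lra.
have e2 : nrm (7 / 48 - w z / 64) <= 7 / 48 + 160^-1.
  rewrite (le_trans (nrmB _ _))// [nrm (w z / 64)]nrmM.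
  have -> : nrm (7 / 48 : R[i]) = 7 / 48 by rewrite nrmM nrmV !nrm_nat.
  by rewrite nrmV nrm_nat; lra.
have e3 : nrm (u z' ^+ 3) <= (10 / 9 * c) ^+ 3.
  by rewrite nrmX lerXn2r ?nnegrE ?nrm_ge0// mulr_ge0// ltW.
rewrite (le_trans (nrmB _ _))// -mulrA [nrm (_ * (w z - w z') / _)]nrmM nrmV nrm_nat.
rewrite [nrm (u z' ^+ 3 * _)]nrmM [nrm ((u z - u z') * _)]nrmM [nrm (_ * (_ - w z /
    64))]nrmM.
have m1 := ler_pM (nrm_ge0 _) (nrm_ge0 _) e1 e2.
have m2 := ler_pM (nrm_ge0 _) (mulr_ge0 (nrm_ge0 _) (nrm_ge0 _)) du m1.
have m3 := ler_pM (nrm_ge0 _) (nrm_ge0 _) e3 dw.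
have -> : d * ((12 / 5) ^+ 3 * (15^-1)) / p ^+ 3 = (12 / 5) ^+ 3 * (15^-1) * (d * c
    ^+ 3).
  by rewrite /c exprVn; ring.
have dc : 0 <= d * c ^+ 3 by rewrite mulr_ge0// exprn_ge0// ltW.
apply: (@le_trans _ _ ((2 * (25 / 36) * (10 / 9) * (3 * (10 / 9) ^+ 2) * (7 / 48 +
    160^-1) +
   (10 / 9) ^+ 3 * (2 * (5 / 8)) / 64) * (d * c ^+ 3))).
  have c1 : c <= 1 by rewrite invf_le1.
  have : (10 / 9 * c) ^+ 3 * (d * (2 * (5 / 8) * 1) * c) <= (10 / 9) ^+ 3 * (2 * (5 /
      8)) * (d * c ^+ 3).
    have -> : (10 / 9 * c) ^+ 3 * (d * (2 * (5 / 8) * 1) * c) =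
      (10 / 9) ^+ 3 * (2 * (5 / 8)) * (d * c ^+ 3) * c by ring.
    by rewrite ler_piMr// mulr_ge0.
  move: m2 m3; lra.
rewrite ler_wpM2r//; lra.
Qed.

Lemma ball_upper (t : R[i]) : nrm (t - 2 * I) <= 2 / 5 -> 0 < complex.Im t.
Proof.
move=> tb; have := le_trans (nrm_Im _) tb; rewrite ImD.
have -> : complex.Im (- (2 * I)) = -2.
  by rewrite ImN -(rmorph_nat (real_complex R)) Im_realM /= mulr1.
by move/ler_normlP => [+ _]; lra.
Qed.

Let box_clim t G : 0 < complex.Im t -> eisenstein2 t 1 G ->
  clim (fun K => row0 K + rest K (fun m n => rem2 (lpt t 1 m n))) G.
Proof.
move=> t0; have [H tH HP] := eisenstein2_rem2 t0 => /(clim_unique tH) <-.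
by have := HP id id cvg_id cvg_id; congr clim; apply/funext => K; rewrite box_rest.
Qed.

Let restB K F F' : rest K F - rest K F' = rest K (fun m n => F m n - F' m n).
Proof. by rewrite -sumrB; apply: eq_bigr => m _; rewrite -sumrB. Qed.

(** The other rows take at most 5/2 (5/2 + 1)/65 < 0.14 from the 13/4 of the row m = 0. *)
Lemma eisenstein2_ball_ge t G : nrm (t - 2 * I) <= 2 / 5 -> eisenstein2 t 1 G ->
  31 / 10 <= nrm G.
Proof.
move=> tb tG; apply: (clim_nrm_ge (box_clim (ball_upper tb) tG)).
near=> K; have K0 : (0 < K)%N by near: K; exact: nbhs_infty_gt.
apply: le_trans (nrm_revD _ _).
have := row0_ge K0.
have := @rest_le K (fun m n => rem2 (lpt t 1 m n)) (65^-1) (65^-1).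
by move=> h h'; have := h ltac:(lra) ltac:(lra) (fun m n => @rem2_ball t m n tb); lra.
Unshelve. all: by end_near.
Qed.

(** The row m = 0 does not involve t and cancels; the remaining rows at t and at i add up to less
    than 8/15. *)
Lemma eisenstein2_ball_i t G L : nrm (t - 2 * I) <= 2 / 5 -> eisenstein2 t 1 G ->
  eisenstein2 I 1 L -> nrm (G - L) <= 8 / 15.
Proof.
move=> tb tG iL; have i_upper : 0 < complex.Im I by exact: ltr01.
apply: (clim_nrm_le (climB (box_clim (ball_upper tb) tG) (box_clim i_upper iL))).
near=> K; rewrite opprD addrACA subrr add0r.
have := nrmB (rest K (fun m n => rem2 (lpt t 1 m n))) (rest K (fun m n => rem2 (lpt I
    1 m n))).
have h := @rest_le K (fun m n => rem2 (lpt t 1 m n)) (65^-1) (65^-1).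
have := h ltac:(lra) ltac:(lra) (fun m n => @rem2_ball t m n tb).
have h' := @rest_le K (fun m n => rem2 (lpt I 1 m n)) (3 / 100) (12^-1).
have := h' ltac:(lra) ltac:(lra) rem2_i.
by lra.
Unshelve. all: by end_near.
Qed.

Lemma eisenstein2_ball_lipschitz t t' G G' :
  nrm (t - 2 * I) <= 2 / 5 -> nrm (t' - 2 * I) <= 2 / 5 ->
  eisenstein2 t 1 G -> eisenstein2 t' 1 G' -> nrm (G - G') <= 3 / 5 * nrm (t - t').
Proof.
move=> tb tb' tG tG'.
apply: (clim_nrm_le (climB (box_clim (ball_upper tb) tG) (box_clim (ball_upper tb')
    tG'))).
near=> K; rewrite opprD addrACA subrr add0r restB.
have d0 := nrm_ge0 (t - t').
have a0 : 0 <= 15^-1 * nrm (t - t') by rewrite mulr_ge0// invr_ge0.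
apply: (le_trans (@rest_le K _ _ _ a0 a0 _)); last by lra.
by move=> m n; exact: rem2_lip.
Unshelve. all: by end_near.
Qed.

End numerics.

(** * The contraction *)

Section solutions.
Variable R : realType.
Local Notation I := (imag R).

Section solve.
Variables (w L : R[i]).
Hypotheses (w_small : nrm w <= 20^-1) (iL : eisenstein2 I 1 L).

Let ball (t : R[i]) := nrm (t - 2 * I) <= 2 / 5.

Let G t : R[i]^o := get [set g : R[i]^o | eisenstein2 t 1 g].

Let GP t : ball t -> eisenstein2 t 1 (G t).
Proof.
move=> /ball_upper /eisenstein2_rem2[g tg _].
by apply: (@getPex _ [set g : R[i]^o | eisenstein2 t 1 g]); exists g.
Qed.

Let T t : R[i] := w + 2 * I * L / G t.

Let nI : nrm (2 * I) = 2.
Proof.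
by rewrite nrmM nrm_nat /imag /= expr0n add0r expr1n sqrtr1 mulr1.
Qed.

Let G_neq0 t : ball t -> G t != 0.
Proof.
by move=> tb; rewrite -nrm_gt0; have := eisenstein2_ball_ge tb (GP tb); lra.
Qed.

(** The centre 2i is the value of T for w = 0 if G(t) is replaced by L. The deviation is at most
    1/20 + 2 (7/40) = 2/5, which ties the radius to the bound on w. *)
Let T_ball t : ball t -> ball (T t).
Proof.
move=> tb; have G0 := G_neq0 tb; rewrite /ball.
have -> : T t - 2 * I = w + 2 * I * ((L - G t) / G t) by rewrite /T; field.
rewrite (le_trans (nrmD _ _))// nrmM nI nrmM nrmV nrm_dist.
have h1 := eisenstein2_ball_ge tb (GP tb).
have h2 := eisenstein2_ball_i tb (GP tb) iL.
have : nrm (G t - L) / nrm (G t) <= 7 / 40 by rewrite ler_pdivrMr; lra.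
by have := w_small; lra.
Qed.

(** The factor is 2 (6/5) (1/5) = 12/25. *)
Let T_contraction t t' : ball t -> ball t' -> nrm (T t - T t') <= 2^-1 * nrm (t - t').
Proof.
move=> tb tb'; have G0 := G_neq0 tb; have G0' := G_neq0 tb'.
have -> : T t - T t' = 2 * I * ((L / G t) * ((G t' - G t) / G t')).
  by rewrite /T; field; rewrite G0 G0'.
rewrite nrmM nI !nrmM !nrmV.
have h1 := eisenstein2_ball_ge tb (GP tb).
have h1' := eisenstein2_ball_ge tb' (GP tb').
have h2 := eisenstein2_ball_i tb (GP tb) iL.
have h3 := eisenstein2_ball_lipschitz tb' tb (GP tb') (GP tb).
rewrite (nrm_dist t') in h3; have d0 := nrm_ge0 (t - t').
have LG : nrm L / nrm (G t) <= 6 / 5.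
  by rewrite ler_pdivrMr; have := nrm_rev L (G t); rewrite (nrm_dist L); lra.
have GG : nrm (G t' - G t) / nrm (G t') <= 1 / 5 * nrm (t - t').
  by rewrite ler_pdivrMr; nra.
have := ler_pM (divr_ge0 (nrm_ge0 _) (nrm_ge0 _)) (divr_ge0 (nrm_ge0 _) (nrm_ge0 _))
    LG GG.
lra.
Qed.

(** Banach iteration from the centre; at a fixed point s Legendre's relation reads p s = s - 2 i L /
    G(s) = w. *)
Lemma p_ball : exists2 s, nrm (s - 2 * I) <= 2 / 5 & p s = Some w.
Proof.
pose u n := iter n T (2 * I).
have ub n : ball (u n).
  elim: n => [|n IH]; last exact: T_ball.
  by rewrite /ball subrr nrm0 divr_ge0.
(* Here 4/5 is the diameter of the disc. *)
have uu k n : nrm (u (k + n)%N - u n) <= 2^-1 ^+ n * (4 / 5).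
  elim: n => [|n IH].
    rewrite expr0 mul1r addn0 (le_trans (nrm_distD (2 * I) _ _))// (nrm_dist (2 * I)).
    by have := ub k; have := ub 0%N; rewrite /ball; lra.
  rewrite addnS (le_trans (T_contraction (ub _) (ub _)))// exprS -mulrA.
  by rewrite ler_wpM2l.
have [s us] : exists s, clim u s.
  apply: (@cauchy_clim _ _ (geometric (4 / 5) 2^-1)).
    by apply: cvg_geometric; rewrite ger0_norm// invf_lt1// ltr1n.
  by move=> m n nm; rewrite -(subnK nm) (le_trans (uu _ _))//= mulrC.
have sb : ball s.
  apply: (clim_nrm_le (climB us (clim_cst (2 * I)))).
  by near=> n; exact: ub.
have sT : s = T s.
  apply: (clim_unique (u := fun n => u n.+1)).
    by move=> e /us[N _ NP]; exists N => // n /leqW; exact: NP.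
  move=> e /us[N _ NP]; exists N => // n /NP {}NP.
  rewrite (le_trans (T_contraction (ub n) sb))//.
  by have := nrm_ge0 (u n - s); lra.
exists s => //.
have [q1 qs] := legendre (ball_upper sb) (GP sb) iL.
have G0 := G_neq0 sb.
rewrite /p qs q1 /sphere_ratio (negbTE G0); congr Some.
by rewrite {1}sT /T; field.
Unshelve. all: by end_near.
Qed.

End solve.

(** * Infinitely many preimages *)

Lemma finite_set_nrm_bounded (A : set R[i]) : finite_set A ->
  exists M : R, forall z, A z -> nrm z <= M.
Proof.
move=> /finite_seqP[s ->]; elim: s => [|x s [M IH]]; first by exists 0.
exists (Num.max (nrm x) M) => z /=; rewrite inE => /predU1P[->|zs].
  by rewrite le_max lexx.
by rewrite le_max IH ?orbT.
Qed.

End solutions.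

Theorem corollary1p3 (R : realType) (w : riemann_sphere R) :
  infinite_set [set tau : R[i]%C | upper_half_plane tau /\ p tau = w].
Proof.
have i_upper : 0 < complex.Im (imag R) by exact: ltr01.
have [L iL _] := eisenstein2_rem2 i_upper.
(* To reach a finite z at -1/s - n, solve p s = -1/(z + n), which is small for large n; to reach
   infinity, solve p s = 0. *)
have [N NP] : exists N : nat, forall n : nat, (N <= n)%N ->
    exists2 s, nrm (s - 2 * imag R) <= 2 / 5 & p (- s^-1 - n%:R) = w.
  case: w => [z|]; last first.
    exists 0%N => n _; have [|s sb ps] := @p_ball _ 0 L _ iL.
      by rewrite nrm0 invr_ge0.
    by exists s => //; rewrite (p_transform _ (ball_upper sb) ps) eqxx.
  (* Then |z + n| >= 20, so the target -1/(z + n) meets the bound 1/20 of [p_ball]. *)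
  exists (Num.bound (nrm z + 20)) => n Nn.
  have n20 : nrm z + 20 <= n%:R.
    apply: (@le_trans _ _ (Num.bound (nrm z + 20))%:R); last by rewrite ler_nat.
    by rewrite ltW// archi_boundP// addr_ge0// nrm_ge0.
  have zn : 20 <= nrm (z + n%:R).
    by rewrite addrC; have := nrm_revD n%:R z; rewrite nrm_nat; lra.
  have zn0 : z + n%:R != 0 by rewrite -nrm_gt0; lra.
  have [|s sb ps] := @p_ball _ (- (z + n%:R)^-1) L _ iL.
    by rewrite nrmN nrmV lef_pV2 ?posrE//; lra.
  exists s => //; rewrite (p_transform _ (ball_upper sb) ps).
  by rewrite oppr_eq0 invr_eq0 (negbTE zn0) invrN opprK invrK addrK.
(* The point s depends on n but stays in the disc, where |s| >= 1; so -1/s - n has modulus at least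
   n - 1, and the preimages are unbounded. *)
move=> /finite_set_nrm_bounded[M MP].
pose n := maxn N (Num.bound (`|M| + 1)).
have [s sb ps] := NP n (leq_maxl _ _).
have s1 : 1 <= nrm s.
  have := nrm_Im (s - 2 * imag R); have := nrm_Im s; rewrite ImD ImN.
  have -> : complex.Im (2 * imag R) = 2.
    by rewrite -(rmorph_nat (real_complex R)) Im_realM /= mulr1.
  by move=> /ler_normlP[_ ?] /ler_normlP[? _]; lra.
have := MP _ (conj (transform_upper _ (ball_upper sb)) ps).
apply/negP; rewrite -ltNge.
have nM : `|M| + 1 < n%:R.
  apply: (@lt_le_trans _ _ (Num.bound (`|M| + 1))%:R); first by rewrite archi_boundP.
  by rewrite ler_nat leq_maxr.
have is1 : nrm (s^-1) <= 1 by rewrite nrmV invf_le1//; lra.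
rewrite -opprD nrmN addrC; have := nrm_revD n%:R s^-1; rewrite nrm_nat.
by have := ler_norm M; lra.
Qed.
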